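(* Let $k$ be a perfect field of characteristic two. For every $j\in k^3$ there exists a curve $C$ of genus two defined over $k$ such that $j(C)=j$.
   Context: A curve of genus two is a smooth, projective, geometrically irreducible curve of genus two. Let $\overline{k}$ be an algebraic closure of $k$. Every curve $C$ of genus two defined over $\overline{k}$ is $\overline{k}$-isomorphic to the smooth projective model of a quasi-affine curve of exactly one of the following types (with $a,b,c\in\overline{k}$), and its $j$-invariant $j(C)=(j_1(C),j_2(C),j_3(C))\in\overline{k}^3$ is defined accordingly: - type (1,1,1): $y^2+y=ax+\frac{b}{x}+\frac{c}{x+1}$ with $abc\neq0$; then $j_1=abc$, $j_2=ab+bc+ca$, $j_3=a+b+c$; - type (1,3): $y^2+y=ax^3+bx+\frac{c}{x}$ with $ac\ne0$; then $j_1=0$, $j_2=ac^3$, $j_3=bc$; - type (5): $y^2+y=ax^5+cx^3$ with $a\neq0$; then $j_1=0$, $j_2=0$, $j_3=c^5/a^3$. (By a theorem of Igusa, $j(C)$ depends only on the $\overline{k}$-isomorphism class of $C$, and two curves of genus two over $\overline{k}$ are isomorphic if and only if they have the same $j$-invariant.) For a curve $C$ defined over $k$, $j(C)$ means the $j$-invariant of its base change to $\overline{k}$. *)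

(* Defs.v *)
From HB Require Import structures.
From mathcomp Require Import all_boot all_order all_algebra all_field.
From mathcomp.multinomials Require Import mpoly.

Set Implicit Arguments.
Unset Strict Implicit.
Unset Printing Implicit Defensive.

Import GRing.Theory.

Local Open Scope ring_scope.

Definition perfect_field (k : fieldType) : Prop :=
  forall p : {poly k}, irreducible_poly p -> separable_poly p.

Definition algebraic_closure (k : fieldType) (K : closedFieldType)
    (iota : {rmorphism k -> K}) : Prop :=
  forall z : K, algebraicOver iota z.

(* A closed subscheme of projective space over k, presented by homogeneous
   equations. The ideal they generate need not be saturated: every notion
   below depends only on the subscheme, or on large degrees of the ideal. *)
Record projective_scheme (k : fieldType) := ProjectiveScheme {
  pdim : nat;
  peqs : seq {mpoly k[pdim.+1]};
  peqs_homog : {in peqs, forall f, f \is homog mdeg}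
}.

Lemma map_mpoly_homog (k K : fieldType) (iota : {rmorphism k -> K}) n
    (s : seq {mpoly k[n]}) :
  {in s, forall f, f \is homog mdeg} ->
  {in map (map_mpoly iota) s, forall f, f \is homog mdeg}.
Proof.
move=> hs _ /mapP[f /hs /homogP[d /dhomogP hd] ->].
apply/homogP; exists d; apply/dhomogP => m; rewrite mcoeff_msupp mcoeff_map_mpoly.
by rewrite fmorph_eq0 => nz; apply: hd; rewrite mcoeff_msupp.
Qed.

Definition base_change (k K : fieldType) (iota : {rmorphism k -> K})
    (C : projective_scheme k) : projective_scheme K :=
  ProjectiveScheme (map_mpoly_homog (iota := iota) (@peqs_homog k C)).

Section HilbertPolynomial.
Variables (k : fieldType) (C : projective_scheme k).

Definition in_ideal (p : {mpoly k[(pdim C).+1]}) : Prop :=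
  exists c : 'I_(size (peqs C)) -> {mpoly k[(pdim C).+1]},
    p = \sum_i c i * (peqs C)`_i.

(* [h] is the dimension of the degree [d] part of the homogeneous coordinate
   ring, i.e. the codimension of the degree [d] part of the ideal. *)
Definition hilbert_function (d h : nat) : Prop :=
  exists V : {vspace dhomog (pdim C).+1 k d},
    (forall p : dhomog (pdim C).+1 k d, p \in V <-> in_ideal p) /\
    (\dim V + h = \dim {: dhomog (pdim C).+1 k d})%N.

Definition hilbert_polynomial (P : {poly rat}) : Prop :=
  exists d0 : nat, forall d : nat, (d0 <= d)%N ->
    exists h : nat, hilbert_function d h /\ P.[d%:R] = h%:R.

Definition dimension (r : nat) : Prop :=
  exists P, hilbert_polynomial P /\ size P = r.+1.

(* Arithmetic genus of a one-dimensional scheme, g = 1 - P(0) = 1 - chi(O); it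
   is the genus when C is a smooth geometrically irreducible curve. *)
Definition genus (g : nat) : Prop :=
  exists P, hilbert_polynomial P /\ P.[0] = 1 - g%:R.

End HilbertPolynomial.

Section Geometry.
Variables (K : closedFieldType) (X : projective_scheme K).

Definition vanishes_at n (s : seq {mpoly K[n]}) (v : 'I_n -> K) : Prop :=
  {in s, forall f, f.@[v] = 0}.

(* Homogeneous coordinates of a geometric point of X. *)
Definition on_scheme (v : 'I_(pdim X).+1 -> K) : Prop :=
  (exists i, v i != 0) /\ vanishes_at (peqs X) v.

(* Irreducibility of the underlying space for the Zariski topology. *)
Definition irreducible_scheme : Prop :=
  (exists v, on_scheme v) /\
  forall s t : seq {mpoly K[(pdim X).+1]},
    {in s, forall f, f \is homog mdeg} ->
    {in t, forall f, f \is homog mdeg} ->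
    (forall v, on_scheme v -> vanishes_at s v \/ vanishes_at t v) ->
    (forall v, on_scheme v -> vanishes_at s v) \/
    (forall v, on_scheme v -> vanishes_at t v).

Definition jacobian (v : 'I_(pdim X).+1 -> K) :
    'M[K]_(size (peqs X), (pdim X).+1) :=
  \matrix_(i, j) ((peqs X)`_i)^`M(j).@[v].

(* Jacobian criterion; it expresses smoothness when every irreducible component
   of X has dimension r. *)
Definition smooth_scheme (r : nat) : Prop :=
  forall v, on_scheme v -> (\rank (jacobian v) + r = pdim X)%N.

Definition smooth_projective_curve : Prop :=
  [/\ irreducible_scheme, dimension X 1 & smooth_scheme 1].

End Geometry.

Definition genus_two_curve (k : fieldType) (K : closedFieldType)
    (iota : {rmorphism k -> K}) (C : projective_scheme k) : Prop :=
  smooth_projective_curve (base_change iota C) /\ genus C 2.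

(* L is the function field of the variety E in affine n-space if it is
   generated over K by the coordinates of a generic point [w] of E. *)
Definition affine_function_field (K : closedFieldType) n
    (E : ('I_n -> K) -> Prop) (L : fieldType) (i : {rmorphism K -> L}) : Prop :=
  exists w : 'I_n -> L,
    (forall p : {mpoly K[n]},
        (map_mpoly i p).@[w] = 0 <-> (forall v, E v -> p.@[v] = 0)) /\
    (forall z : L, exists p q : {mpoly K[n]},
        (map_mpoly i q).@[w] != 0 /\
        z = (map_mpoly i p).@[w] / (map_mpoly i q).@[w]).

Definition projective_function_field (K : closedFieldType)
    (X : projective_scheme K) (L : fieldType) (i : {rmorphism K -> L}) : Prop :=
  exists w : 'I_(pdim X).+1 -> L,
    (forall p : {mpoly K[(pdim X).+1]}, p \is homog mdeg ->
        (map_mpoly i p).@[w] = 0 <-> (forall v, on_scheme v -> p.@[v] = 0)) /\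
    (forall z : L, exists d, exists p q : {mpoly K[(pdim X).+1]},
        [/\ p \is d.-homog for mdeg, q \is d.-homog for mdeg,
            (map_mpoly i q).@[w] != 0 &
            z = (map_mpoly i p).@[w] / (map_mpoly i q).@[w]]).

(* The smooth projective model of E is the smooth projective curve with the
   same function field; it is unique up to isomorphism, so this says that X is
   isomorphic to it. *)
Definition smooth_projective_model (K : closedFieldType) n
    (E : ('I_n -> K) -> Prop) (X : projective_scheme K) : Prop :=
  smooth_projective_curve X /\
  exists (L : fieldType) (i : {rmorphism K -> L}),
    affine_function_field E i /\ projective_function_field X i.

Section QuasiAffineTypes.
Variables (K : closedFieldType) (a b c : K).

Definition curve111 (v : 'I_2 -> K) : Prop :=
  let x := v ord0 in let y := v ord_max in
  [/\ x != 0, x + 1 != 0 & y ^+ 2 + y = a * x + b / x + c / (x + 1)].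

Definition curve13 (v : 'I_2 -> K) : Prop :=
  let x := v ord0 in let y := v ord_max in
  x != 0 /\ y ^+ 2 + y = a * x ^+ 3 + b * x + c / x.

Definition curve5 (v : 'I_2 -> K) : Prop :=
  let x := v ord0 in let y := v ord_max in
  y ^+ 2 + y = a * x ^+ 5 + c * x ^+ 3.

End QuasiAffineTypes.

(* [j_invariant X j1 j2 j3] : the j-invariant of the genus two curve X over an
   algebraically closed field of characteristic two is (j1, j2, j3). *)
Inductive j_invariant (K : closedFieldType) (X : projective_scheme K) :
    K -> K -> K -> Prop :=
| JType111 (a b c : K) : a * b * c != 0 ->
    smooth_projective_model (curve111 a b c) X ->
    j_invariant X (a * b * c) (a * b + b * c + c * a) (a + b + c)
| JType13 (a b c : K) : a * c != 0 ->
    smooth_projective_model (curve13 a b c) X ->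
    j_invariant X 0 (a * c ^+ 3) (b * c)
| JType5 (a c : K) : a != 0 ->
    smooth_projective_model (curve5 a c) X ->
    j_invariant X 0 0 (c ^+ 5 / a ^+ 3).

(* Main.v *)
(* In characteristic two, a curve y^2 + h y = f with deg h <= 3 and deg f <= 6 embeds
   in P^4 by (1 : x : x^2 : x^3 : y), as the intersection of the cone over the twisted
   cubic with one more quadric; its coordinate ring has dimension 6 d - 1 in degree
   d >= 1, whence dimension one and genus two, and it is smooth as soon as
   f h'^2 + f'^2 does not vanish at a zero of h, including at infinity.

   It remains to choose h and f over k. Types (1,3) and (5) are reached by explicit
   coefficients. If j1 <> 0, then a, b, c are the roots of
   E = X^3 + j3 X^2 + j2 X + j1. If E has a multiple root, then that root is a square
   root of j2, which is in k because k is perfect, so that a, b, c are in k. Otherwise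
   take h = E: the homography moving the poles oo, 0, 1 of the type (1,1,1) equation to
   a, b, c turns it into y^2 + y = N / (D E) + constant, where D = j1 + j2 j3 is the
   square root of the discriminant and N = X E'^3 mod E is defined over k; the constant
   is removed over the algebraically closed field by a translation of y. *)

Require Import Defs.
From HB Require Import structures.
From mathcomp Require Import all_boot all_order all_algebra all_field.
From mathcomp.multinomials Require Import mpoly.
From mathcomp Require Import ring zify.
From Stdlib Require Import Classical_Prop.

Set Implicit Arguments.
Unset Strict Implicit.
Unset Printing Implicit Defensive.

Import GRing.Theory.

Local Open Scope ring_scope.

(** No smooth plane curve has genus two, and the affine equation closes up in the plane with a
    singularity at infinity; P^4 is used because it gives y the weight of x^3. The geometry is then
    read off one generic point with values in L = K(x, y), where 1 and y are linearly independent
    over K[x]: a form vanishes there exactly when it lies in the ideal, and this yields the Hilbert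
    function, irreducibility and the function field together. The choice f = h g makes z = y / h
    satisfy z^2 + z = g / h up to sign, the shape of all three types, whose poles are the zeros of h
    and possibly infinity. The cube in N comes from residues. The homography gives the pole a the
    residue a E'(a)^2 / D, while N / (D E) has residue N(a) / (D E'(a)) there, so N(a) must be a
    E'(a)^3. *)

(* Unlike hornerE, this rule does not reassociate the surrounding products. *)
Definition hornerRE :=
  (hornerD, hornerN, hornerM, hornerZ, horner_exp, hornerX, hornerC).

(** * Evaluation of polynomials through a ring morphism *)

Section PolynomialInduction.
Variables (n : nat) (R : comNzRingType) (P : {mpoly R[n]} -> Prop).
Hypothesis PC : forall c, P c%:MP.
Hypothesis PX : forall i, P 'X_i.
Hypothesis PD : forall p q, P p -> P q -> P (p + q).
Hypothesis PM : forall p q, P p -> P q -> P (p * q).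

Lemma mpoly_alg_ind p : P p.
Proof.
rewrite [p]mpolyE; apply: (big_ind P) => [|//|m _]; first by rewrite -mpolyC0.
rewrite -mul_mpolyC mpolyXE_id; apply: PM => //.
apply: (big_ind P) => [|//|i _]; first by rewrite -mpolyC1.
by elim: (m i) => [|e IH]; rewrite ?expr0 -?mpolyC1 // exprS; apply: PM.
Qed.

End PolynomialInduction.

Section MapMeval.
Variables (n : nat) (R S : comNzRingType) (i : {rmorphism R -> S}) (w : 'I_n -> S).
Implicit Types p q : {mpoly R[n]}.

Lemma map_mevalD p q :
  (map_mpoly i (p + q)).@[w] = (map_mpoly i p).@[w] + (map_mpoly i q).@[w].
Proof. by rewrite [map_mpoly i _]rmorphD mevalD. Qed.

Lemma map_mevalN p : (map_mpoly i (- p)).@[w] = - (map_mpoly i p).@[w].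
Proof. by rewrite [map_mpoly i _]rmorphN mevalN. Qed.

Lemma map_mevalM p q :
  (map_mpoly i (p * q)).@[w] = (map_mpoly i p).@[w] * (map_mpoly i q).@[w].
Proof. by rewrite [map_mpoly i _]rmorphM mevalM. Qed.

Lemma map_mevalXn p m : (map_mpoly i (p ^+ m)).@[w] = (map_mpoly i p).@[w] ^+ m.
Proof. by rewrite [map_mpoly i _]rmorphXn [LHS]rmorphXn. Qed.

Lemma map_mevalZ c p : (map_mpoly i (c *: p)).@[w] = i c * (map_mpoly i p).@[w].
Proof. by rewrite map_mpolyZ mevalZ. Qed.

Lemma map_mevalC c : (map_mpoly i c%:MP).@[w] = i c.
Proof. by rewrite map_mpolyC mevalC. Qed.

Lemma map_mevalX j : (map_mpoly i 'X_j).@[w] = w j.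
Proof. by rewrite map_mpolyX mevalXU. Qed.

Lemma map_meval_sum (I : Type) (r : seq I) (P : pred I) (G : I -> {mpoly R[n]}) :
  (map_mpoly i (\sum_(j <- r | P j) G j)).@[w] = \sum_(j <- r | P j) (map_mpoly i (G j)).@[w].
Proof. by rewrite [map_mpoly i _]rmorph_sum [LHS]rmorph_sum. Qed.

End MapMeval.

Lemma map_mpoly_idfun n (R : nzRingType) (p : {mpoly R[n]}) : map_mpoly idfun p = p.
Proof. by apply/mpolyP => m; rewrite mcoeff_map_mpoly. Qed.

(** * Quadratic extensions of K(x) *)

Section GenericPair.
Variables (F L : fieldType) (i : {rmorphism F -> L}) (x y : L).

(** Linear independence of 1 and [y] over F[x]; the case B = 0 contains the transcendence of [x]. *)
Definition free_pair := forall A B : {poly F},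
  (map_poly i A).[x] + (map_poly i B).[x] * y = 0 -> A = 0 /\ B = 0.

(** [L] is generated as a field by F, [x] and [y], stated as an induction principle: to describe all
    elements as quotients it is then enough to check closure under the field operations. *)
Definition generating_pair := forall P : L -> Prop,
  (forall c, P (i c)) -> P x -> P y ->
  (forall u v, P u -> P v -> P (u + v)) ->
  (forall u v, P u -> P v -> P (u * v)) ->
  (forall u, P u -> P u^-1) -> forall z, P z.

Lemma free_horner_neq0 (A : {poly F}) : free_pair -> A != 0 -> (map_poly i A).[x] != 0.
Proof.
move=> xy_free; apply: contra => /eqP eA; have [|-> //] := xy_free A 0.
by rewrite eA rmorph0 horner0 mul0r addr0.
Qed.

End GenericPair.

Lemma fraction_numden (R : idomainType) (z : {fraction R}) :
  exists p q : R, q != 0 /\ z = tofrac p / tofrac q.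
Proof.
elim/quotW: z => r; exists (\n_r), (\d_r); split; first exact: denom_ratioP.
apply: (canRL (mulfK _)); first by rewrite tofrac_eq0 denom_ratioP.
rewrite -[LHS]/(FracField.mul _ (tofrac _)).
rewrite !piE; apply/eqmodP; rewrite /= FracField.equivfE /FracField.mulf.
by rewrite !numden_Ratio ?mulf_neq0 ?oner_eq0 ?denom_ratioP // !mulr1 mulrC.
Qed.

Lemma fraction_numden_coprime (K : fieldType) (z : {fraction {poly K}}) :
  exists p q : {poly K}, [/\ q != 0, coprimep p q & z = tofrac p / tofrac q].
Proof.
have [p [q [q0 ->]]] := fraction_numden z.
have g0 : gcdp p q != 0 by rewrite gcdp_eq0 negb_and q0 orbT.
exists (p %/ gcdp p q), (q %/ gcdp p q); split.
- by rewrite dvdp_div_eq0 ?dvdp_gcdr.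
- by apply: coprimep_div_gcd; rewrite q0 orbT.
rewrite -{1}(divpK (dvdp_gcdl p q)) -{3}(divpK (dvdp_gcdr p q)) !rmorphM /=.
by rewrite -mulf_div divff ?mulr1 // tofrac_eq0.
Qed.

(** K[x] is integrally closed, so a root in K(x) of a monic quadratic over K[x] lies in K[x]. The
    hypothesis thus makes the quadratic irreducible over K(x), and [L] is obtained by adjoining a
    root. *)
Lemma function_field_exists (K : fieldType) (h f : {poly K}) :
  (forall g, g ^+ 2 + h * g + f != 0) ->
  exists (L : fieldType) (i : {rmorphism K -> L}) (x y : L),
    [/\ y ^+ 2 + (map_poly i h).[x] * y + (map_poly i f).[x] = 0,
        free_pair i x y & generating_pair i x y].
Proof.
move=> nog; pose F : fieldType := {fraction {poly K}}.
pose H : F := tofrac h; pose G : F := tofrac f.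
pose p : {poly F} := 'X^2 + H *: 'X + G%:P.
have sp : size p = 3%N.
  rewrite /p -addrA size_polyDl size_polyXn // (leq_ltn_trans (size_polyD _ _)) //.
  rewrite gtn_max size_polyC (leq_ltn_trans (size_scale_leq _ _)) ?size_polyX //.
  by case: (G != 0).
have nr : forall r, ~~ root p r.
  move=> r; apply/negP => /rootP; rewrite !hornerE => er.
  have [a [b [b0 cop er']]] := fraction_numden_coprime r.
  have B0 : tofrac b != 0 by rewrite tofrac_eq0.
  have e : a ^+ 2 + h * a * b + f * b ^+ 2 = 0.
    apply/eqP; rewrite -tofrac_eq0 !rmorphD !(rmorphXn, rmorphM) /= -/H -/G.
    have -> : tofrac a = r * tofrac b by rewrite er' divfK.
    by apply/eqP; rewrite -[RHS](mul0r (tofrac b ^+ 2)) -er; ring.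
  have : b %| a ^+ 2.
    have -> : a ^+ 2 = (- (h * a + f * b)) * b.
      by apply/eqP; rewrite -subr_eq0 -e; apply/eqP; ring.
    exact: dvdp_mull.
  (* The denominator [b] divides the numerator and is prime to it, so it is a constant and the root
     is a polynomial. *)
  rewrite expr2 Gauss_dvdpl ?[coprimep b a]coprimep_sym // => ba.
  have : size b = 1%N.
    by apply/eqP; rewrite -coprimepp (coprimep_dvdr ba).
  move/eqP/size_poly1P => [c c0 eb].
  have := nog (c^-1 *: a); apply/negP; rewrite negbK.
  move: e; rewrite eb => e.
  suff -> : (c^-1 *: a) ^+ 2 + h * (c^-1 *: a) + f =
     (c^-1 ^+ 2)%:P * (a ^+ 2 + h * a * c%:P + f * c%:P ^+ 2) by rewrite e mulr0.
  have ec : (c^-1)%:P * c%:P = 1 :> {poly K} by rewrite -polyCM mulVf.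
  rewrite -mul_polyC polyC_exp; set d := (c^-1)%:P in ec *.
  have -> : f = f * (d * c%:P) ^+ 2 by rewrite ec; ring.
  rewrite ec.
  have -> : h * (d * a) = h * (d * a) * (d * c%:P) by rewrite ec; ring.
  by ring: ec.
have irr : irreducible_poly p by apply: cubic_irreducible; rewrite ?sp.
have [L dL [y ry gen]] := irredp_FAdjoin irr.
pose e : {rmorphism K -> L} := (in_alg L \o (@FracField.tofrac _)) \o polyC.
pose x : L := in_alg L (tofrac 'X).
have ev (A : {poly K}) : (map_poly e A).[x] = in_alg L (tofrac A).
  elim/poly_ind: A => [|A c IH]; first by rewrite !rmorph0 horner0.
  by rewrite !rmorphD !rmorphM /= map_polyX map_polyC !hornerE IH.
exists L, e, x, y; split.
- move/rootP: ry; rewrite !rmorphD /= map_polyXn map_polyZ map_polyX map_polyC.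
  by rewrite !hornerE !ev.
- move=> A B; rewrite !ev => eAB.
  suff B0 : B = 0.
    split=> //; apply/eqP; move: eAB; rewrite B0 !rmorph0 mul0r addr0 => /eqP.
    by rewrite fmorph_eq0 tofrac_eq0.
  apply/eqP; apply: contraT => B0; case/negP: (nr (- tofrac A / tofrac B)).
  suff Ey : y = in_alg L (- tofrac A / tofrac B).
    by rewrite -(fmorph_root (in_alg L)); move: ry; rewrite Ey.
  have B0' : in_alg L (tofrac B) != 0 by rewrite fmorph_eq0 tofrac_eq0.
  rewrite fmorph_div rmorphN; apply: (mulIf B0'); rewrite divfK //.
  by apply/eqP; rewrite -addr_eq0 addrC [y * _]mulrC eAB.
move=> P Pc Px Py PD PM PV z.
have PT A : P (in_alg L (tofrac A)).
  rewrite -ev; elim/poly_ind: A => [|A c IH].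
    by rewrite rmorph0 horner0 -(rmorph0 e).
  rewrite rmorphD rmorphM /= map_polyX map_polyC hornerD hornerM hornerX hornerC.
  by apply: PD; [apply: PM | apply: Pc].
have PF r : P (in_alg L r).
  have [a [b [b0 ->]]] := fraction_numden r.
  by rewrite fmorph_div; apply: PM; [apply: PT | apply: PV; apply: PT].
have /Fadjoin_polyP[q /polyOver1P[q' ->] ->] : z \in <<1; y>>%VS by rewrite gen memvf.
elim/poly_ind: q' => [|q' c IH]; first by rewrite rmorph0 horner0 -(rmorph0 e).
rewrite rmorphD rmorphM /= map_polyX map_polyC hornerD hornerM hornerX hornerC.
by apply: PD; [apply: PM | apply: PF].
Qed.

(** * Points and generic points of affine plane curves *)

Lemma closed_quadratic (K : closedFieldType) (a b c : K) :
  a != 0 -> exists y, a * y ^+ 2 + b * y + c = 0.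
Proof.
move=> a0; have /closed_rootP[y /rootP] : size (a *: 'X^2 + b *: 'X + c%:P) != 1%N.
  have -> // : size (a *: 'X^2 + b *: 'X + c%:P) = 3%N.
  rewrite -addrA size_polyDl size_scale ?size_polyXn //.
  rewrite (leq_ltn_trans (size_polyD _ _)) // gtn_max size_polyC.
  by rewrite (leq_ltn_trans (size_scale_leq _ _)) ?size_polyX //; case: (c != 0).
by rewrite !(hornerD, hornerZ, hornerXn, hornerX, hornerC) => e; exists y.
Qed.

Lemma closed_poly_eq0 (K : closedFieldType) (p : {poly K}) :
  (forall x, p.[x] = 0) -> p = 0.
Proof.
move=> p0; apply/eqP; apply: contraT => /closed_nonrootP[x].
by rewrite /root p0 eqxx.
Qed.

Lemma all_ord2 (P : 'I_2 -> Prop) : P ord0 -> P ord_max -> forall i, P i.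
Proof.
by move=> P0 P1 [[|[|//]] lt_i2]; [move: P0 | move: P1]; congr P; apply: val_inj.
Qed.

Section PlaneCurve.
Variables (F : fieldType) (s eta phi : {poly F}).

Definition on_plane_curve (M : fieldType) (i : {rmorphism F -> M}) (x y : M) :=
  (map_poly i s).[x] * y ^+ 2 + (map_poly i eta).[x] * y + (map_poly i phi).[x] = 0.

(* A and B do not depend on the point, which will be a point over K as well as
   the generic point. *)
Lemma plane_curve_reduction (p : {mpoly F[2]}) :
  exists n (A B : {poly F}), forall (M : fieldType) (i : {rmorphism F -> M})
    (w : 'I_2 -> M), on_plane_curve i (w ord0) (w ord_max) ->
    (map_poly i s).[w ord0] ^+ n * (map_mpoly i p).@[w] =
      (map_poly i A).[w ord0] + (map_poly i B).[w ord0] * w ord_max.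
Proof.
elim/mpoly_alg_ind: p => [c|j|p q [n [A [B IHp]]] [n' [A' [B' IHq]]]
  |p q [n [A [B IHp]]] [n' [A' [B' IHq]]]].
- exists 0%N, c%:P, 0 => M i w _.
  by rewrite map_mpolyC mevalC map_polyC hornerC rmorph0 horner0 /=; ring.
- elim/all_ord2: j; [exists 0%N, 'X, 0 | exists 0%N, 0, 1] => M i w _.
    by rewrite map_mpolyX mevalXU map_polyX hornerX rmorph0 horner0; ring.
  by rewrite map_mpolyX mevalXU rmorph1 hornerC rmorph0 horner0; ring.
- exists (n + n')%N, (s ^+ n' * A + s ^+ n * A'), (s ^+ n' * B + s ^+ n * B') => M i w Hw.
  rewrite [map_mpoly i _]rmorphD mevalD !rmorphD !rmorphM /= !rmorphXn /= !hornerRE exprD.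
  have := IHp M i w Hw; have := IHq M i w Hw; set S := (map_poly i s).[_] => e1 e2.
  transitivity (S ^+ n' * (S ^+ n * (map_mpoly i p).@[w])
    + S ^+ n * (S ^+ n' * (map_mpoly i q).@[w])).
  by ring.
  by rewrite e1 e2; ring.
(* Expand s (A + B y) (A' + B' y) and replace s y^2 by - eta y - phi; this factor [s] is the extra
   unit in the exponent. *)
exists (n + n').+1, (s * A * A' - B * B' * phi), (s * (A * B' + A' * B) - B * B' * eta).
move=> M i w Hw.
rewrite [map_mpoly i _]rmorphM mevalM !(rmorphD, rmorphN, rmorphM) /= !hornerRE exprS exprD.
have := IHp M i w Hw; have := IHq M i w Hw; move: Hw; rewrite /on_plane_curve.
set X := w ord0; set Y := w ord_max; set S := (map_poly i s).[X] => Hw e1 e2.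
transitivity (S * (S ^+ n * (map_mpoly i p).@[w]) * (S ^+ n' * (map_mpoly i q).@[w])).
  by ring.
rewrite e1 e2.
set a := (map_poly i A).[X]; set b := (map_poly i B).[X].
set a' := (map_poly i A').[X]; set b' := (map_poly i B').[X].
have eY : S * Y ^+ 2 = - ((map_poly i eta).[X] * Y) - (map_poly i phi).[X].
  by apply/eqP; rewrite -opprD -addr_eq0 addrA Hw.
by ring: eY.
Qed.

End PlaneCurve.

Section PlaneCurvePoints.
Variables (K : closedFieldType) (L : fieldType) (i : {rmorphism K -> L}).
Variables (s eta phi : {poly K}) (w : 'I_2 -> L).
Hypotheses (s0 : s != 0) (w_free : free_pair i (w ord0) (w ord_max)).
Hypothesis w_on : on_plane_curve s eta phi i (w ord0) (w ord_max).

(** Both directions use the form A + B y of [plane_curve_reduction]. At [w], freeness turns a zero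
    into A = B = 0. Conversely, every x with s(x) nonzero lies under a point because [K] is closed,
    so vanishing at the points forces the norm of A + B y to be zero. *)
Lemma plane_curve_vanishing (p : {mpoly K[2]}) :
  (map_mpoly i p).@[w] = 0 <->
  (forall v : 'I_2 -> K, s.[v ord0] != 0 ->
     s.[v ord0] * v ord_max ^+ 2 + eta.[v ord0] * v ord_max + phi.[v ord0] = 0 ->
     p.@[v] = 0).
Proof.
have [n [A [B red]]] := plane_curve_reduction s eta phi p.
have redK v : s.[v ord0] * v ord_max ^+ 2 + eta.[v ord0] * v ord_max + phi.[v ord0] = 0 ->
     s.[v ord0] ^+ n * p.@[v] = A.[v ord0] + B.[v ord0] * v ord_max.
  move=> Hv; have := red K idfun v; rewrite /on_plane_curve !map_poly_id //.
  by rewrite map_mpoly_idfun; apply.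
have redL := red L i w w_on; have S0 := free_horner_neq0 w_free s0.
split=> [ep v sv ev | vp].
  move: redL; rewrite ep mulr0 => /esym/w_free[A0 B0].
  move: (redK v ev); rewrite A0 B0 !horner0 mul0r addr0 => /eqP.
  by rewrite mulf_eq0 expf_eq0 (negPf sv) andbF => /eqP.
suff AB0 : (map_poly i A).[w ord0] + (map_poly i B).[w ord0] * w ord_max = 0.
  move: redL; rewrite AB0 => /eqP.
  by rewrite mulf_eq0 expf_eq0 (negPf S0) andbF => /eqP.
(* The norm of A + B y, times s, vanishes at every point of K. *)
have norm0 : s * A ^+ 2 - eta * A * B + phi * B ^+ 2 = 0.
  apply/eqP; rewrite -[_ == 0]orFb -(negPf s0) -mulf_eq0; apply/eqP.
  apply: closed_poly_eq0 => x; rewrite hornerM; have [->|sx] := eqVneq s.[x] 0.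
    by rewrite mul0r.
  have [y ey] := closed_quadratic eta.[x] phi.[x] sx.
  pose v (j : 'I_2) := if j == ord0 then x else y.
  move: (redK v ey) (vp v sx ey) => /= e1 e2; rewrite e2 mulr0 in e1.
  have eA : A.[x] = - (B.[x] * y) by apply/eqP; rewrite -addr_eq0 -e1.
  have ey' : s.[x] * y ^+ 2 = - (eta.[x] * y) - phi.[x].
    by apply/eqP; rewrite -opprD -addr_eq0 addrA ey.
  by rewrite !hornerRE eA; ring: ey'.
have := congr1 (fun q => (map_poly i q).[w ord0]) norm0.
rewrite !(rmorphXn, rmorphD, rmorphN, rmorphM) /= rmorph0 horner0 !hornerRE.
move: w_on w_free; rewrite /on_plane_curve /free_pair.
set x := w ord0; set y := w ord_max => ey fr eN.
(* The second factor is s times the conjugate of A + B y, the other root of the quadratic being - y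
   - eta / s. *)
have : ((map_poly i A).[x] + (map_poly i B).[x] * y) *
  ((map_poly i (s * A - eta * B)).[x] + (map_poly i (- s * B)).[x] * y) = 0.
  rewrite !(rmorphD, rmorphN, rmorphM) /= !hornerRE.
  set S := (map_poly i s).[x] in ey eN *; set a := (map_poly i A).[x] in eN *.
  set b := (map_poly i B).[x] in eN *; set e := (map_poly i eta).[x] in ey eN *.
  set f := (map_poly i phi).[x] in ey eN *.
  transitivity (S * a ^+ 2 - e * a * b + f * b ^+ 2 - b ^+ 2 * (S * y ^+ 2 + e * y + f)).
    by ring.
  by rewrite eN ey mulr0 subr0.
move/eqP; rewrite mulf_eq0 => /orP[/eqP //|/eqP/fr[]].
move=> eA /eqP; rewrite mulf_eq0 oppr_eq0 (negPf s0) /= => /eqP B0.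
move/eqP: eA; rewrite B0 mulr0 subr0 mulf_eq0 (negPf s0) /= => /eqP ->.
by rewrite !rmorph0 !horner0 mul0r addr0.
Qed.

End PlaneCurvePoints.

(** * Codimension, and ideals of projective schemes *)

Lemma complement_space (F : fieldType) (U : vectType F) (S : U -> Prop) m
    (X : 'I_m -> U) :
  S 0 -> (forall p q, S p -> S q -> S (p + q)) -> (forall c p, S p -> S (c *: p)) ->
  (forall p, exists c : 'I_m -> F, S (p - \sum_j c j *: X j)) ->
  (forall c : 'I_m -> F, S (\sum_j c j *: X j) -> forall j, c j = 0) ->
  exists V : {vspace U}, (forall p, p \in V <-> S p) /\ (\dim V + m = \dim {:U})%N.
Proof.
move=> S0 SD SZ red ind.
pose W := <<[tuple X j | j < m]>>%VS; pose b := vbasis {:U}.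
have Xj (j : 'I_m) : [tuple X j | j < m]`_j = X j by rewrite -tnth_nth tnth_mktuple.
have dW : \dim W = m.
  suff /eqP : free [tuple X j | j < m] by rewrite size_tuple.
  apply/freeP => c ec j; apply: ind.
  rewrite (eq_bigr (fun l : 'I_m => c l *: [tuple X j | j < m]`_l)) ?ec // => l _.
  by rewrite Xj.
have [c Sc] := fin_all_exists (fun l : 'I_(\dim {:U}) => red b`_l).
(* [S] is a mere predicate; the space realizing it is spanned by the basis vectors minus their
   reductions. By [ind] it meets the span [W] of the [X j] trivially, and together they fill [U]. *)
pose V := <<[tuple b`_l - \sum_j c l j *: X j | l < \dim {:U}]>>%VS.
have VS p : p \in V -> S p.
  move/coord_span=> ->; apply: (big_ind S) => // l _; apply: (SZ).
  by rewrite -tnth_nth tnth_mktuple.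
have WE p : p \in W -> exists d : 'I_m -> F, p = \sum_j d j *: X j.
  move/coord_span=> {1}->; exists (coord [tuple X j | j < m] ^~ p).
  by apply: eq_bigr => l _; rewrite Xj.
have SW0 p : S p -> p \in W -> p = 0.
  move=> Sp /WE[d ed]; rewrite ed big1 // => j _.
  by rewrite (ind d) ?scale0r // -ed.
have SumW d : \sum_j d j *: X j \in W.
  apply: rpred_sum => j _; apply: rpredZ; apply: memv_span.
  by apply/tnthP; exists j; rewrite tnth_mktuple.
have VW : (V + W)%VS = fullv.
  apply/eqP; rewrite eqEsubv subvf -{1}(span_basis (vbasisP {:U})); apply/span_subvP => u.
  case/(nthP 0) => l; rewrite size_tuple => lt_l <-; pose l' := Ordinal lt_l.
  rewrite -[_`_l](subrK (\sum_j c l' j *: X j)); apply: memv_add => //.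
  by apply: memv_span; apply/tnthP; exists l'; rewrite tnth_mktuple.
exists V; split=> [p|].
  split=> [|Sp]; first exact: VS.
  have : p \in (V + W)%VS by rewrite VW memvf.
  case/memv_addP => v vV [u uW ep].
  suff -> : p = v by [].
  rewrite ep (SW0 u) ?addr0 //.
  have -> : u = p + (-1) *: v by rewrite ep scaleN1r addrC addKr.
  by apply: SD => //; apply: SZ; apply: VS.
rewrite -VW -[in LHS]dW dimv_disjoint_sum //; apply/eqP; rewrite -subv0.
by apply/subvP => p /memv_capP[/VS Sp pW]; rewrite (SW0 p) ?mem0v.
Qed.

Section Ideal.
Variables (k : fieldType) (C : projective_scheme k).

Lemma in_ideal_gen q : q \in peqs C -> @in_ideal k C q.
Proof.
move=> qC; have lt_q : (index q (peqs C) < size (peqs C))%N by rewrite index_mem.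
exists (fun j => (j == Ordinal lt_q)%:R); rewrite (bigD1 (Ordinal lt_q)) //= eqxx.
rewrite mul1r nth_index // big1 ?addr0 // => j /negPf ->; exact: mul0r.
Qed.

Lemma in_idealD p q : @in_ideal k C p -> @in_ideal k C q -> @in_ideal k C (p + q).
Proof.
move=> [c ->] [d ->]; exists (fun j => c j + d j); rewrite -big_split.
by apply: eq_bigr => j _; rewrite mulrDl.
Qed.

Lemma in_idealM p q : @in_ideal k C q -> @in_ideal k C (p * q).
Proof.
move=> [c ->]; exists (fun j => p * c j); rewrite big_distrr.
by apply: eq_bigr => j _; rewrite /= mulrA.
Qed.

Lemma in_ideal0 : @in_ideal k C 0.
Proof. by exists (fun=> 0); rewrite big1 // => j _; exact: mul0r. Qed.

Lemma in_idealZ c p : @in_ideal k C p -> @in_ideal k C (c *: p).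
Proof. by rewrite -mul_mpolyC; exact: in_idealM. Qed.

Lemma in_ideal_eval (L : fieldType) (i : {rmorphism k -> L})
    (w : 'I_(pdim C).+1 -> L) p :
  {in peqs C, forall q, (map_mpoly i q).@[w] = 0} ->
  @in_ideal k C p -> (map_mpoly i p).@[w] = 0.
Proof.
move=> w0 [c ->]; rewrite [map_mpoly i _]rmorph_sum; rewrite [LHS]rmorph_sum big1 //= => j _.
by rewrite rmorphM mevalM (w0 (peqs C)`_j) ?mulr0 // mem_nth.
Qed.

End Ideal.

(** * Genus two curves in four-dimensional projective space *)

Section Embedding.
Variables (k : fieldType) (h f : {poly k}).

Definition xvar (j : nat) : {mpoly k[5]} := 'X_(inord j).

Local Notation U := xvar.

(* Homogeneous coordinates 0, 1, 2, 3, 4 are 1, x, x ^+ 2, x ^+ 3, y on the affine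
   curve y ^+ 2 + h y + f = 0. *)
Definition sextic_form : {mpoly k[5]} :=
  f`_0 *: (U 0 * U 0) + f`_1 *: (U 0 * U 1) + f`_2 *: (U 1 * U 1) + f`_3 *: (U 0 * U 3)
  + f`_4 *: (U 2 * U 2) + f`_5 *: (U 2 * U 3) + f`_6 *: (U 3 * U 3).

Definition cubic_form : {mpoly k[5]} :=
  h`_0 *: U 0 + h`_1 *: U 1 + h`_2 *: U 2 + h`_3 *: U 3.

Definition curve_eqs : seq {mpoly k[5]} :=
  [:: U 0 * U 2 - U 1 * U 1; U 1 * U 3 - U 2 * U 2; U 0 * U 3 - U 1 * U 2;
      U 4 * U 4 + cubic_form * U 4 + sextic_form].

Lemma xvar_homog j : U j \is 1.-homog.
Proof. by rewrite dhomogX; apply/eqP; exact: mdeg1. Qed.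

Lemma xvarM_homog j l : U j * U l \is 2.-homog.
Proof. exact: (dhomogM (xvar_homog j) (xvar_homog l)). Qed.

Lemma curve_eqs_homog : {in curve_eqs, forall q, q \is homog mdeg}.
Proof.
have ch : cubic_form \is 1.-homog by rewrite !rpredD ?rpredZ ?xvar_homog.
move=> q qin; apply/homogP; exists 2; move: q qin; apply/allP.
rewrite /= /sextic_form !(rpredB, rpredD, rpredZ, xvarM_homog) //=.
exact: (dhomogM ch (xvar_homog 4)).
Qed.

End Embedding.

Local Notation U j := (xvar _ j).

Section CurvePoints.
Variables (k : fieldType) (h f : {poly k}) (L : fieldType) (i : {rmorphism k -> L}).

Definition curve_point (w : 'I_5 -> L) := let u j := w (inord j) in
  [/\ u 0%N * u 2%N = u 1%N * u 1%N, u 1%N * u 3%N = u 2%N * u 2%N,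
      u 0%N * u 3%N = u 1%N * u 2%N &
      u 4%N * u 4%N
      + (i h`_0 * u 0%N + i h`_1 * u 1%N + i h`_2 * u 2%N + i h`_3 * u 3%N) * u 4%N
      + (i f`_0 * (u 0%N * u 0%N) + i f`_1 * (u 0%N * u 1%N) + i f`_2 * (u 1%N * u 1%N)
         + i f`_3 * (u 0%N * u 3%N) + i f`_4 * (u 2%N * u 2%N) + i f`_5 * (u 2%N * u 3%N)
         + i f`_6 * (u 3%N * u 3%N)) = 0].

Lemma curve_pointP (w : 'I_5 -> L) :
  {in curve_eqs h f, forall q, (map_mpoly i q).@[w] = 0} <-> curve_point w.
Proof.
pose ev (q : {mpoly k[5]}) := (map_mpoly i q).@[w].
have EU j : ev (U j) = w (inord j) by exact: map_mevalX.
have ED p q : ev (p + q) = ev p + ev q by exact: map_mevalD.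
have EM p q : ev (p * q) = ev p * ev q by exact: map_mevalM.
have EZ c p : ev (c *: p) = i c * ev p by exact: map_mevalZ.
have EB p q : ev (p - q) = ev p - ev q by rewrite /ev map_mevalD map_mevalN.
have E4 (a b c d : k) (p q r s : {mpoly k[5]}) :
    ev (a *: p + b *: q + c *: r + d *: s) =
    i a * ev p + i b * ev q + i c * ev r + i d * ev s.
  by rewrite 3!ED 4!EZ.
have E7 (a b c d e e' e'' : k) (p q r s t t' t'' : {mpoly k[5]}) :
    ev (a *: p + b *: q + c *: r + d *: s + e *: t + e' *: t' + e'' *: t'') =
    i a * ev p + i b * ev q + i c * ev r + i d * ev s + i e * ev t + i e' * ev t'
    + i e'' * ev t''.
  by rewrite 6!ED 7!EZ.
have e1 : ev (U 0 * U 2 - U 1 * U 1) = w (inord 0) * w (inord 2) - w (inord 1) * w (inord 1).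
  by rewrite EB !EM !EU.
have e2 : ev (U 1 * U 3 - U 2 * U 2) = w (inord 1) * w (inord 3) - w (inord 2) * w (inord 2).
  by rewrite EB !EM !EU.
have e3 : ev (U 0 * U 3 - U 1 * U 2) = w (inord 0) * w (inord 3) - w (inord 1) * w (inord 2).
  by rewrite EB !EM !EU.
have e4 : ev (U 4 * U 4 + cubic_form h * U 4 + sextic_form f) =
  ev (U 4) * ev (U 4) + ev (cubic_form h) * ev (U 4) + ev (sextic_form f) by rewrite 2!ED 2!EM.
rewrite E4 E7 !EM !EU in e4.
rewrite /curve_point; split=> [w0|[p1 p2 p3 p4] q].
  split; [apply/eqP; rewrite -subr_eq0; apply/eqP..|].
  - by rewrite -e1 /ev w0 // !inE eqxx ?orbT.
  - by rewrite -e2 /ev w0 // !inE eqxx ?orbT.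
  - by rewrite -e3 /ev w0 // !inE eqxx ?orbT.
  by rewrite -e4 /ev w0 // !inE eqxx ?orbT.
rewrite !inE => /or4P[] /eqP ->.
- by rewrite -/(ev _) e1 p1 subrr.
- by rewrite -/(ev _) e2 p2 subrr.
- by rewrite -/(ev _) e3 p3 subrr.
by rewrite -/(ev _) e4.
Qed.

End CurvePoints.

Section GenericPoint.
Variables (k L : fieldType) (i : {rmorphism k -> L}) (h f : {poly k}) (x y : L).

Definition cone_point (j : 'I_5) : L := if j == inord 4 then y else x ^+ j.

Lemma cone_point_xvar j : (j < 4)%N -> cone_point (inord j) = x ^+ j.
Proof.
by move=> lt_j; rewrite /cone_point -val_eqE /= !inordK ?ltn_eqF // ltnS ltnW.
Qed.

Lemma cone_point4 : cone_point (inord 4) = y.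
Proof. by rewrite /cone_point eqxx. Qed.

Lemma cone_pointP : (size h <= 4)%N -> (size f <= 7)%N ->
  y ^+ 2 + (map_poly i h).[x] * y + (map_poly i f).[x] = 0 ->
  curve_point h f i cone_point.
Proof.
move=> sh sf; rewrite (@horner_coef_wide _ 4) ?size_map_poly //.
rewrite (@horner_coef_wide _ 7) ?size_map_poly // !big_ord_recl !big_ord0 /=.
rewrite !coef_map /bump /= => e; rewrite /curve_point cone_point4 !cone_point_xvar //.
by split; try ring; rewrite -[RHS]e; ring.
Qed.

End GenericPoint.

(* The standard monomial of degree d that restricts to x ^+ e on the twisted
   cubic. *)
Fixpoint stdmon (k : fieldType) (d e : nat) : {mpoly k[5]} :=
  if d is d'.+1 then U (minn 3 e) * stdmon k d' (e - 3) else 1.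

Lemma stdmon_homog k d e : stdmon k d e \is d.-homog.
Proof.
elim: d e => [|d IH] e /=; first exact: dhomog1.
exact: (dhomogM (xvar_homog k (minn 3 e)) (IH (e - 3)%N)).
Qed.

(** * Normal forms modulo the ideal of the curve *)

Section Reduction.
Variables (k : fieldType) (h f : {poly k}).
Hypothesis hom : {in curve_eqs h f, forall q, q \is homog mdeg}.

Let C := ProjectiveScheme hom.
Local Notation I := (@in_ideal k C).
Implicit Types p q r : {mpoly k[5]}.

Lemma congr_refl p : I (p - p).
Proof. by rewrite subrr; exact: in_ideal0. Qed.

Lemma congr_sym p q : I (p - q) -> I (q - p).
Proof. by move=> Ipq; rewrite -opprB -scaleN1r; exact: in_idealZ. Qed.

Lemma congr_trans p q r : I (p - q) -> I (q - r) -> I (p - r).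
Proof. by move=> Ipq Iqr; rewrite -(subrK q p) -addrA; exact: in_idealD. Qed.

Lemma congr_mul r p q : I (p - q) -> I (r * p - r * q).
Proof. by move=> Ipq; rewrite -mulrBr; exact: in_idealM. Qed.

(** Modulo the minors, a product of two of the first four coordinates depends only on the sum of the
    indices, its exponent on the twisted cubic; the representatives are the standard monomials of
    degree two. *)
Lemma xvar_mul a b : (a <= 3)%N -> (b <= 3)%N ->
  I (U a * U b - (if (a + b <= 3)%N then U 0 * U (a + b) else U 3 * U (a + b - 3))).
Proof.
have q1 : I (U 1 * U 1 - U 0 * U 2) by apply/congr_sym/in_ideal_gen; rewrite inE eqxx.
have q2 : I (U 2 * U 2 - U 3 * U 1).
  by rewrite [U 3 * _]mulrC; apply/congr_sym/in_ideal_gen; rewrite !inE eqxx orbT.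
have q3 : I (U 1 * U 2 - U 0 * U 3) by apply/congr_sym/in_ideal_gen; rewrite !inE eqxx !orbT.
move: a b => [|[|[|[|//]]]] [|[|[|[|//]]]] _ _ /=; rewrite ?subn0 ?addn0 //;
  first [exact: congr_refl | by rewrite mulrC; exact: congr_refl | by rewrite mulrC].
Qed.

(** If 3 <= e, a factor [U 3] is set aside and induction applies. Otherwise the monomial is [U e]
    times a power of [U 0], and only [U w * U e] needs straightening. *)
Lemma xvar_stdmon w d e : (w <= 3)%N -> (e <= 3 * d)%N ->
  I (U w * stdmon k d e - stdmon k d.+1 (e + w)).
Proof.
elim: d e => [|d IH] e w3 e3d.
  have -> : e = 0%N by lia.
  rewrite /= add0n; have -> : minn 3 w = w by lia.
  exact: congr_refl.
have [e3|e3] := leqP 3 e.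
  have -> : stdmon k d.+2 (e + w) = U 3 * stdmon k d.+1 (e - 3 + w).
    by rewrite /=; congr (U _ * stdmon k d.+1 _); lia.
  have -> : stdmon k d.+1 e = U 3 * stdmon k d (e - 3) by rewrite /=; congr (U _ * _); lia.
  rewrite mulrCA; apply: congr_mul; apply: IH; lia.
have E j : stdmon k d.+2 (e + w) = U (minn 3 (e + w)) * stdmon k d.+1 (e + w - 3) by [].
have -> : stdmon k d.+1 e = U e * stdmon k d 0.
  by rewrite /=; congr (U _ * stdmon k d _); lia.
rewrite mulrA [_ * U e]mulrC; have := xvar_mul (ltnW e3) w3.
have [le3|gt3] := leqP (e + w) 3.
  have -> : stdmon k d.+2 (e + w) = U 0 * U (e + w) * stdmon k d 0.
    rewrite mulrAC mulrC /=; congr (U _ * _); first by lia.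
    by congr (U _ * stdmon k d _); lia.
  by move=> c; rewrite ![_ * stdmon k d 0]mulrC; apply: congr_mul.
have -> : stdmon k d.+2 (e + w) = U 3 * U (e + w - 3) * stdmon k d 0.
  rewrite -mulrA /=; congr (U _ * _); first by lia.
  by congr (U _ * stdmon k d _); lia.
by move=> c; rewrite ![_ * stdmon k d 0]mulrC; apply: congr_mul.
Qed.

Lemma sum_delta m e (G : nat -> {mpoly k[5]}) : (e < m)%N ->
  \sum_(0 <= l < m) (l == e)%:R *: G l = G e.
Proof.
move=> lt_e; rewrite (bigD1_seq e) ?mem_index_iota ?iota_uniq //= eqxx scale1r.
by rewrite big1 ?addr0 // => l /negPf->; exact: scale0r.
Qed.

Lemma sum_scale0 m (G : nat -> {mpoly k[5]}) : \sum_(0 <= l < m) 0 *: G l = 0.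
Proof. by rewrite big1 // => l _; exact: scale0r. Qed.

(* For d = 0 the truncated bound 3 * d - 2 makes the second sum empty. *)
Definition reducible d p := exists a b : nat -> k,
  I (p - (\sum_(0 <= e < (3 * d).+1) a e *: stdmon k d e
          + \sum_(0 <= e < 3 * d - 2) b e *: (U 4 * stdmon k d.-1 e))).

Lemma reducibleD d p q : reducible d p -> reducible d q -> reducible d (p + q).
Proof.
move=> [a [b Ip]] [a' [b' Iq]]; exists (fun e => a e + a' e), (fun e => b e + b' e).
have S m (c c' : nat -> k) (G : nat -> {mpoly k[5]}) :
    \sum_(0 <= e < m) (c e + c' e) *: G e =
    \sum_(0 <= e < m) c e *: G e + \sum_(0 <= e < m) c' e *: G e.
  by rewrite -big_split; apply: eq_bigr => e _; rewrite scalerDl.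
by rewrite !S addrACA opprD addrACA; exact: in_idealD.
Qed.

Lemma reducibleZ d c p : reducible d p -> reducible d (c *: p).
Proof.
move=> [a [b Ip]]; exists (fun e => c * a e), (fun e => c * b e).
have S m (c' : nat -> k) (G : nat -> {mpoly k[5]}) :
    \sum_(0 <= e < m) (c * c' e) *: G e = c *: \sum_(0 <= e < m) c' e *: G e.
  by rewrite scaler_sumr; apply: eq_bigr => e _; rewrite scalerA.
by rewrite !S -scalerDr -scalerBr; exact: in_idealZ.
Qed.

Lemma reducible_congr d p q : I (p - q) -> reducible d q -> reducible d p.
Proof. by move=> Ipq [a [b Iq]]; exists a, b; exact: congr_trans Ipq Iq. Qed.

Lemma reducible0 d : reducible d 0.
Proof.
exists (fun=> 0), (fun=> 0).
by rewrite !sum_scale0 addr0 subrr; exact: in_ideal0.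
Qed.

Lemma reducible_stdmon d e : (e <= 3 * d)%N -> reducible d (stdmon k d e).
Proof.
move=> le_e; exists (fun l => (l == e)%:R), (fun=> 0).
by rewrite sum_delta // sum_scale0 addr0; exact: congr_refl.
Qed.

Lemma reducible_ystdmon d e : (e <= 3 * d)%N -> reducible d.+1 (U 4 * stdmon k d e).
Proof.
move=> le_e; exists (fun=> 0), (fun l => (l == e)%:R).
by rewrite sum_delta /= ?sum_scale0 ?add0r; [exact: congr_refl | lia].
Qed.

Lemma reducible_xvar w d e : (w <= 3)%N -> (e <= 3 * d)%N ->
  reducible d.+1 (U w * stdmon k d e).
Proof.
move=> w3 e3; apply: reducible_congr (xvar_stdmon w3 e3) _.
by apply: reducible_stdmon; lia.
Qed.

Lemma reducible_xvar2 v w d e : (v <= 3)%N -> (w <= 3)%N -> (e <= 3 * d)%N ->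
  reducible d.+2 (U v * U w * stdmon k d e).
Proof.
move=> v3 w3 e3; apply: (@reducible_congr _ _ (U v * stdmon k d.+1 (e + w))).
  by rewrite -mulrA; apply/congr_mul/xvar_stdmon.
by apply: reducible_xvar => //; lia.
Qed.

Lemma reducible_yxvar w d e : (w <= 3)%N -> (e <= 3 * d)%N ->
  reducible d.+2 (U w * U 4 * stdmon k d e).
Proof.
move=> w3 e3; apply: (@reducible_congr _ _ (U 4 * stdmon k d.+1 (e + w))).
  by rewrite mulrAC mulrC; apply/congr_mul/xvar_stdmon.
by apply: reducible_ystdmon; lia.
Qed.

(** The last quadric trades the square of [U 4] for terms at most linear in [U 4], which is why
    normal forms contain [U 4] at most once. *)
Lemma reducible_yy d e : (e <= 3 * d)%N -> reducible d.+2 (U 4 * U 4 * stdmon k d e).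
Proof.
move=> e3; set q := cubic_form h * U 4 + sextic_form f.
apply: (@reducible_congr _ _ (-1 *: (q * stdmon k d e))).
  rewrite scaleN1r opprK -mulrDl mulrC; apply: in_idealM.
  by apply: in_ideal_gen; rewrite /q addrA !inE eqxx !orbT.
apply: reducibleZ; rewrite /q /cubic_form /sextic_form mulrDl.
apply: reducibleD.
  have E (a b c g : k) (p1 p2 p3 p4 r s : {mpoly k[5]}) :
    (a *: p1 + b *: p2 + c *: p3 + g *: p4) * r * s =
    a *: (p1 * r * s) + b *: (p2 * r * s) + c *: (p3 * r * s) + g *: (p4 * r * s).
    by rewrite 6!mulrDl 8!scalerAl.
  by rewrite E; do ![apply: reducibleD | apply: reducibleZ | exact: reducible_yxvar].
have E (a b c g a' b' c' : k) (p1 p2 p3 p4 q1 q2 q3 s : {mpoly k[5]}) :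
    (a *: p1 + b *: p2 + c *: p3 + g *: p4 + a' *: q1 + b' *: q2 + c' *: q3) * s =
    a *: (p1 * s) + b *: (p2 * s) + c *: (p3 * s) + g *: (p4 * s)
    + a' *: (q1 * s) + b' *: (q2 * s) + c' *: (q3 * s).
  by rewrite 6!mulrDl 7!scalerAl.
by rewrite E; do ![apply: reducibleD | apply: reducibleZ | exact: reducible_xvar2].
Qed.

Lemma reducibleM w d p : (w <= 4)%N -> reducible d p -> reducible d.+1 (U w * p).
Proof.
move=> w4 [a [b Ip]]; apply: reducible_congr (congr_mul (U w) Ip) _.
rewrite mulrDr !mulr_sumr; have y_case : (w == 4) || (w <= 3)%N by lia.
have sl (c : k) (q r : {mpoly k[5]}) : q * (c *: r) = c *: (q * r) by rewrite scalerAr.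
apply: reducibleD.
  rewrite big_seq_cond; apply: big_ind => [||e]; [exact: reducible0 | exact: reducibleD |].
  rewrite andbT mem_index_iota => /andP[_ lt_e]; rewrite sl; apply: reducibleZ.
  case/orP: y_case => [/eqP->|w3]; first by apply: reducible_ystdmon; lia.
  by apply: reducible_xvar => //; lia.
rewrite big_seq_cond; apply: big_ind => [||e]; [exact: reducible0 | exact: reducibleD |].
rewrite andbT mem_index_iota => /andP[_ lt_e]; rewrite sl; apply: reducibleZ.
(* For d = 0 the range of [e] is empty. *)
case: d lt_e {Ip} => // d lt_e; rewrite mulrA [d.+1.-1]/=.
case/orP: y_case => [/eqP->|w3]; first by apply: reducible_yy; lia.
by apply: reducible_yxvar => //; lia.
Qed.

Lemma reducible_mpolyX (m : 'X_{1..5}) : reducible (mdeg m) 'X_[m].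
Proof.
move Dd: (mdeg m) => d; elim: d m Dd => [|d IH] m Dd.
  have /eqP-> : m == 0%MM by rewrite -mdeg_eq0 Dd.
  by rewrite mpolyX0; exact: (reducible_stdmon (leq0n (3 * 0))).
have [j mj] : exists j, m j != 0%N.
  apply/existsP; apply: contraT; rewrite negb_exists => /forallP m0.
  suff : mdeg m = 0%N by rewrite Dd.
  by rewrite mdegE big1 // => j _; apply/eqP; rewrite -[_ == _]negbK m0.
have Dm : m = (U_(j) + (m - U_(j)))%MM by rewrite addmC submK ?lep1mP.
rewrite Dm mpolyXD -[j]inord_val; apply: reducibleM; first by rewrite -ltnS.
by apply: IH; apply/eqP; rewrite -eqSS -Dd {2}Dm mdegD mdeg1 inord_val.
Qed.

Lemma reducible_homog d p : p \is d.-homog -> reducible d p.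
Proof.
move/dhomogP => hp; rewrite [p]mpolyE big_seq.
apply: big_ind => [||m mp]; [exact: reducible0 | exact: reducibleD | apply: reducibleZ].
by rewrite -(hp m mp); exact: reducible_mpolyX.
Qed.

End Reduction.

(** * Hilbert function and Hilbert polynomial *)

Section CoordinateRing.
Variables (k : fieldType) (h f : {poly k}).
Hypothesis hom : {in curve_eqs h f, forall q, q \is homog mdeg}.
Variables (L : fieldType) (i : {rmorphism k -> L}) (x y : L).
Hypotheses (sh : (size h <= 4)%N) (sf : (size f <= 7)%N) (xy_free : free_pair i x y).
Hypothesis xy_on : y ^+ 2 + (map_poly i h).[x] * y + (map_poly i f).[x] = 0.

Let C := ProjectiveScheme hom.
Local Notation I := (@in_ideal k C).
Local Notation ev p := ((map_mpoly i p).@[cone_point x y]).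

Lemma ev_in_ideal p : I p -> ev p = 0.
Proof. by apply: in_ideal_eval; apply/curve_pointP/cone_pointP. Qed.

Lemma ev_stdmon d e : (e <= 3 * d)%N -> ev (stdmon k d e) = x ^+ e.
Proof.
elim: d e => [|d IH] e le_e.
  have -> : e = 0%N by lia.
  by rewrite /= -mpolyC1 map_mevalC rmorph1.
rewrite /= map_mevalM map_mevalX cone_point_xvar ?IH -?exprD; last by lia.
  by congr (_ ^+ _); lia.
by lia.
Qed.

Lemma ev_reduced d (a b : nat -> k) :
  ev (\sum_(0 <= e < (3 * d).+1) a e *: stdmon k d e
      + \sum_(0 <= e < 3 * d - 2) b e *: (U 4 * stdmon k d.-1 e)) =
  (map_poly i (\poly_(e < (3 * d).+1) a e)).[x]
  + (map_poly i (\poly_(e < 3 * d - 2) b e)).[x] * y.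
Proof.
have H m (c : nat -> k) :
    (map_poly i (\poly_(e < m) c e)).[x] = \sum_(0 <= e < m) i (c e) * x ^+ e.
  rewrite poly_def rmorph_sum horner_sum big_mkord; apply: eq_bigr => e _.
  by rewrite /= map_polyZ map_polyXn hornerZ hornerXn.
rewrite map_mevalD !map_meval_sum !H mulr_suml; congr (_ + _).
  apply: eq_big_nat => e /andP[_ lt_e]; rewrite map_mevalZ ev_stdmon //; lia.
apply: eq_big_nat => e /andP[_ lt_e].
rewrite map_mevalZ map_mevalM map_mevalX cone_point4 ev_stdmon; last by lia.
by rewrite -mulrA [y * _]mulrC.
Qed.

Lemma ev_reduced_eq0 d (a b : nat -> k) :
  ev (\sum_(0 <= e < (3 * d).+1) a e *: stdmon k d e
      + \sum_(0 <= e < 3 * d - 2) b e *: (U 4 * stdmon k d.-1 e)) = 0 ->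
  (forall e, (e < (3 * d).+1)%N -> a e = 0) /\ (forall e, (e < 3 * d - 2)%N -> b e = 0).
Proof.
rewrite ev_reduced => /xy_free[A0 B0]; split=> e lt_e.
  by have := congr1 (fun q : {poly k} => q`_e) A0; rewrite coef_poly lt_e coef0.
by have := congr1 (fun q : {poly k} => q`_e) B0; rewrite coef_poly lt_e coef0.
Qed.

(** A normal form vanishing at the generic point has zero coefficients, because 1 and [y] are free
    over k[x]. Together with [ev_in_ideal], the ideal is in each degree the kernel of evaluation at
    this point. *)
Lemma ev_homog_eq0 p d : p \is d.-homog -> ev p = 0 -> I p.
Proof.
move=> hp ep; have [a [b Ir]] := reducible_homog hom hp.
have := ev_in_ideal Ir; rewrite map_mevalD map_mevalN ep sub0r => /eqP.
rewrite oppr_eq0 => /eqP/ev_reduced_eq0[a0 b0].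
move: Ir; rewrite big_nat big1 => [|e /andP[_ lt_e]]; last by rewrite a0 ?scale0r.
by rewrite big_nat big1 => [|e /andP[_ lt_e]]; rewrite ?addr0 ?subr0 // b0 ?scale0r.
Qed.

(** The two blocks restrict to x^e for e <= 3 d + 3 and to y x^e for e <= 3 d. Their sizes are
    written as successors so that [inord] applies to each. *)
Definition std_basis_fun d (j : 'I_((3 * d).+4 + (3 * d).+1)) : {mpoly k[5]} :=
  match split j with
  | inl e => stdmon k d.+1 e
  | inr e => U 4 * stdmon k d e
  end.

Lemma std_basis_homog d j : @std_basis_fun d j \is d.+1.-homog.
Proof.
rewrite /std_basis_fun; case: split => e; first exact: stdmon_homog.
exact: (dhomogM (xvar_homog k 4) (stdmon_homog k d e)).
Qed.

Lemma sum_std_basis d (a b : nat -> k) :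
  \sum_j (match split j with inl e => a e | inr e => b e end) *: @std_basis_fun d j =
  \sum_(0 <= e < (3 * d.+1).+1) a e *: stdmon k d.+1 e
  + \sum_(0 <= e < 3 * d.+1 - 2) b e *: (U 4 * stdmon k d.+1.-1 e).
Proof.
have -> : (3 * d.+1).+1 = (3 * d).+4 by lia.
have -> : (3 * d.+1 - 2)%N = (3 * d).+1 by lia.
rewrite big_split_ord !big_mkord /std_basis_fun; congr (_ + _); apply: eq_bigr => e _.
  by rewrite -[lshift _ e]/(unsplit (inl e)) unsplitK.
by rewrite -[rshift _ e]/(unsplit (inr e)) unsplitK.
Qed.

Lemma hilbert_function_curve d : hilbert_function C d.+1 (6 * d + 5).
Proof.
pose X j : dhomog 5 k d.+1 := DHomog (std_basis_homog j).
pose S (p : dhomog 5 k d.+1) := I p.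
have XE c : val (\sum_j c j *: X j) = \sum_j c j *: std_basis_fun j.
  by rewrite raddf_sum; apply: eq_bigr => j _.
have red (p : dhomog 5 k d.+1) : exists c, S (p - \sum_j c j *: X j).
  have [a [b Ip]] := reducible_homog hom (dhomog_is_dhomog p).
  exists (fun j => match split j with inl e => a e | inr e => b e end).
  by rewrite /S /= -[mpoly_of_dhomog (\sum_j _)]/(val _) XE sum_std_basis.
have ind (c : 'I_((3 * d).+4 + (3 * d).+1) -> k) : S (\sum_j c j *: X j) -> forall j, c j = 0.
  pose a (e : nat) := c (lshift _ (inord e)); pose b (e : nat) := c (rshift _ (inord e)).
  have cE j : c j = match split j with inl e => a e | inr e => b e end.
    by case: splitP => e; [rewrite /a | rewrite /b] => ej; congr c; apply: val_inj;
      rewrite /= inord_val.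
  have -> : \sum_j c j *: X j =
      \sum_j (match split j with inl e => a e | inr e => b e end) *: X j.
    by apply: eq_bigr => j _; rewrite cE.
  rewrite /S -[mpoly_of_dhomog _]/(val _) XE sum_std_basis.
  move=> /ev_in_ideal/ev_reduced_eq0[a0 b0] j.
  by rewrite cE; case: split => e; [apply: a0 | apply: b0]; have := ltn_ord e; lia.
have [|||V [VS dV]] := @complement_space _ _ S _ X _ _ _ red ind.
- exact: in_ideal0.
- by move=> p q Sp Sq; exact: (in_idealD Sp Sq).
- by move=> c p Sp; exact: (in_idealZ c Sp).
by exists V; split=> //; rewrite -dV; congr (_ + _)%N; lia.
Qed.

End CoordinateRing.

Section HilbertPolynomial.
Variables (k : fieldType) (h f : {poly k}).
Hypothesis hom : {in curve_eqs h f, forall q, q \is homog mdeg}.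
Variables (L : fieldType) (i : {rmorphism k -> L}) (x y : L).
Hypotheses (sh : (size h <= 4)%N) (sf : (size f <= 7)%N) (xy_free : free_pair i x y).
Hypothesis xy_on : y ^+ 2 + (map_poly i h).[x] * y + (map_poly i f).[x] = 0.

Lemma hilbert_polynomial_curve :
  hilbert_polynomial (ProjectiveScheme hom) (6 *: 'X - 1).
Proof.
(* At 0 the polynomial takes the value -1, so it can only count dimensions from degree one on. *)
exists 1%N => [[//|d] _]; exists (6 * d + 5)%N.
split; first exact: (hilbert_function_curve hom sh sf xy_free xy_on).
rewrite !hornerRE mulrSr natrD natrM; ring.
Qed.

Lemma dimension_curve : dimension (ProjectiveScheme hom) 1.
Proof.
exists (6 *: 'X - 1); split; first exact: hilbert_polynomial_curve.
by rewrite size_polyDl ?size_polyN ?size_scale ?size_polyX ?size_polyC.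
Qed.

Lemma genus_curve : genus (ProjectiveScheme hom) 2.
Proof.
exists (6 *: 'X - 1); split; first exact: hilbert_polynomial_curve.
by rewrite !hornerRE; ring.
Qed.

End HilbertPolynomial.

(** * Irreducibility and function field *)

Lemma map_meval_comp_mpoly (R S : comNzRingType) (i : {rmorphism R -> S}) n m
    (lq : n.-tuple {mpoly R[m]}) (w : 'I_m -> S) p :
  (map_mpoly i (p \mPo lq)).@[w] =
  (map_mpoly i p).@[fun j => (map_mpoly i (tnth lq j)).@[w]].
Proof.
elim/mpoly_alg_ind: p => [c|j|p q IHp IHq|p q IHp IHq].
- by rewrite comp_mpolyC !map_mevalC.
- by rewrite comp_mpolyXU map_mevalX -tnth_nth.
- by rewrite rmorphD !map_mevalD IHp IHq.
by rewrite rmorphM !map_mevalM IHp IHq.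
Qed.

Section Geometry.
Variables (K : closedFieldType) (h f : {poly K}).
Hypothesis hom : {in curve_eqs h f, forall q, q \is homog mdeg}.
Variables (L : fieldType) (i : {rmorphism K -> L}) (x y : L).
Hypotheses (sh : (size h <= 4)%N) (sf : (size f <= 7)%N) (xy_free : free_pair i x y).
Hypothesis xy_on : y ^+ 2 + (map_poly i h).[x] * y + (map_poly i f).[x] = 0.

Let X := ProjectiveScheme hom.
Local Notation ev p := ((map_mpoly i p).@[cone_point x y]).

Lemma vanishes_at_curveP (v : 'I_5 -> K) :
  vanishes_at (curve_eqs h f) v <-> curve_point h f idfun v.
Proof.
by rewrite -curve_pointP; split=> v0 q /v0; rewrite map_mpoly_idfun.
Qed.

(** A form in the ideal vanishes on the whole curve. For the converse the chart where the first
    coordinate is 1 suffices: there the form becomes a polynomial in x and y vanishing on y^2 + h y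
    + f = 0, and the plane case with s = 1 applies. *)
Lemma ev_eq0P (p : {mpoly K[5]}) : p \is homog mdeg ->
  ev p = 0 <-> (forall v, on_scheme (X := X) v -> p.@[v] = 0).
Proof.
move=> /homogP[d hp]; split=> [ep v [_ vX] | vp].
  have Ip := ev_homog_eq0 hom sh sf xy_free xy_on hp ep.
  by rewrite -[p]map_mpoly_idfun; apply: in_ideal_eval Ip => q /vX; rewrite map_mpoly_idfun.
pose lq : 5.-tuple {mpoly K[2]} :=
  [tuple if j == inord 4 then 'X_ord_max else 'X_ord0 ^+ j | j < 5].
pose w (j : 'I_2) := if j == ord0 then x else y.
have lqE (M : comNzRingType) (g : {rmorphism K -> M}) (v : 'I_2 -> M) (j : 'I_5) :
    (map_mpoly g (tnth lq j)).@[v] = if j == inord 4 then v ord_max else v ord0 ^+ j.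
  by rewrite tnth_mktuple; case: ifP => _; rewrite ?map_mevalXn map_mevalX.
have w_on : on_plane_curve 1 h f i (w ord0) (w ord_max).
  by rewrite /on_plane_curve rmorph1 hornerC mul1r.
have [_] := @plane_curve_vanishing K L i 1 h f w (oner_neq0 _) xy_free w_on (p \mPo lq).
rewrite map_meval_comp_mpoly => H; rewrite -[RHS]H.
  by apply: meval_eq => j; rewrite lqE.
move=> v _; rewrite hornerC mul1r => ev; rewrite comp_mpoly_meval.
rewrite (@meval_eq _ _ _ (cone_point (v ord0) (v ord_max))); last first.
  by move=> j; rewrite -[tnth lq j]map_mpoly_idfun lqE.
apply: vp; split; first by exists (inord 0); rewrite cone_point_xvar ?expr0 ?oner_neq0.
apply/vanishes_at_curveP/cone_pointP => //; rewrite !map_poly_id //.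
Qed.

Lemma irreducible_curve : irreducible_scheme X.
Proof.
split.
  (* The curve is nonempty: it has a point at infinity (0 : 0 : 0 : 1 : z). *)
  have [z ez] := closed_quadratic h`_3 f`_6 (oner_neq0 K).
  exists (fun j => if j == inord 4 then z else (j == inord 3)%:R); split.
    exists (inord 3); rewrite eqxx ifF ?oner_neq0 //.
    by rewrite -val_eqE /= !inordK.
  apply/vanishes_at_curveP; rewrite /curve_point -!val_eqE /= !inordK //= .
  by split; try ring; rewrite -[RHS]ez /=; ring.
move=> s t hs ht st.
have [s0|] := boolP (all (fun q => ev q == 0) s).
  left=> v vX q qs; move: v vX; apply/ev_eq0P; first exact: hs.
  by apply/eqP; exact: (allP s0).
(* Evaluation takes values in a field: once some [p] of [s] is nonzero at the generic point, every
   [q] of [t] vanishes there, as the product does. *)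
case/allPn=> p ps p0; right=> v vX q qt; move: v vX; apply/ev_eq0P; first exact: ht.
have : ev (p * q) = 0.
  apply/ev_eq0P.
    have /homogP[d hd] := hs p ps; have /homogP[e he] := ht q qt.
    by apply/homogP; exists (d + e)%N; exact: dhomogM.
  move=> v vX; rewrite mevalM.
  by case: (st v vX) => [/(_ p ps)|/(_ q qt)] ->; rewrite ?mul0r ?mulr0.
by rewrite map_mevalM => /eqP; rewrite mulf_eq0 (negPf p0) => /eqP.
Qed.

Lemma projective_function_field_curve :
  generating_pair i x y -> projective_function_field X i.
Proof.
move=> gen; exists (cone_point x y); split; first exact: ev_eq0P.
have U0 : ev (U 0) = 1 by rewrite map_mevalX cone_point_xvar ?expr0.
apply: gen => [c|||u v [d [p [q [hp hq q0 ->]]]] [e [r [s [hr hs s0 ->]]]]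
    |u v [d [p [q [hp hq q0 ->]]]] [e [r [s [hr hs s0 ->]]]]|u [d [p [q [hp hq q0 ->]]]]].
- exists 0%N, c%:MP, 1; split; rewrite ?dhomog1 //.
  + by rewrite -[c%:MP]mulr1 mul_mpolyC rpredZ ?dhomog1.
  + by rewrite -mpolyC1 map_mevalC rmorph1 oner_neq0.
  by rewrite -mpolyC1 !map_mevalC rmorph1 divr1.
- exists 1%N, (U 1), (U 0); split; rewrite ?xvar_homog ?U0 ?oner_neq0 //.
  by rewrite map_mevalX cone_point_xvar // divr1 expr1.
- exists 1%N, (U 4), (U 0); split; rewrite ?xvar_homog ?U0 ?oner_neq0 //.
  by rewrite map_mevalX cone_point4 divr1.
- exists (d + e)%N, (p * s + r * q), (q * s); split.
  + by apply: rpredD; [exact: dhomogM | rewrite addnC; exact: dhomogM].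
  + exact: dhomogM.
  + by rewrite map_mevalM mulf_neq0.
  by rewrite map_mevalD !map_mevalM addf_div.
- exists (d + e)%N, (p * r), (q * s); split; try exact: dhomogM.
    by rewrite map_mevalM mulf_neq0.
  by rewrite !map_mevalM mulf_div.
have [p0|p0] := eqVneq (ev p) 0.
  by exists d, p, q; split=> //; rewrite p0 mul0r invr0.
by exists d, q, p; split=> //; rewrite invf_div.
Qed.

End Geometry.

(** * Smoothness by the Jacobian criterion *)

Section Derivatives.
Variables (R : fieldType) (h f : {poly R}) (v : 'I_5 -> R) (j : 'I_5).

Let u l := v (inord l).
Let d l : R := (inord l == j)%:R.
Local Notation D p := ((mderiv j p).@[v]).

Lemma deriv_curve_eqs : [/\
  D (curve_eqs h f)`_0 = d 0%N * u 2%N + u 0%N * d 2%N - (d 1%N * u 1%N + u 1%N * d 1%N),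
  D (curve_eqs h f)`_1 = d 1%N * u 3%N + u 1%N * d 3%N - (d 2%N * u 2%N + u 2%N * d 2%N),
  D (curve_eqs h f)`_2 = d 0%N * u 3%N + u 0%N * d 3%N - (d 1%N * u 2%N + u 1%N * d 2%N) &
  D (curve_eqs h f)`_3 = d 4%N * u 4%N + u 4%N * d 4%N
    + ((h`_0 * d 0%N + h`_1 * d 1%N + h`_2 * d 2%N + h`_3 * d 3%N) * u 4%N
       + (h`_0 * u 0%N + h`_1 * u 1%N + h`_2 * u 2%N + h`_3 * u 3%N) * d 4%N)
    + (f`_0 * (d 0%N * u 0%N + u 0%N * d 0%N) + f`_1 * (d 0%N * u 1%N + u 0%N * d 1%N)
       + f`_2 * (d 1%N * u 1%N + u 1%N * d 1%N) + f`_3 * (d 0%N * u 3%N + u 0%N * d 3%N)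
       + f`_4 * (d 2%N * u 2%N + u 2%N * d 2%N) + f`_5 * (d 2%N * u 3%N + u 2%N * d 3%N)
       + f`_6 * (d 3%N * u 3%N + u 3%N * d 3%N))].
Proof.
have EX l : (U l : {mpoly R[5]}).@[v] = u l by exact: mevalXU.
have DX l : D (U l) = d l.
  rewrite mderivX mnm1E mevalZ /d; case: eqVneq => [->|_]; rewrite ?mul0r //.
  have -> : (U_(j) - U_(j) = 0)%MM by apply/mnmP => m; rewrite !mnmE subnn.
  by rewrite mpolyX0 meval1 mulr1.
have DD p q : D (p + q) = D p + D q by rewrite mderivD mevalD.
have DB p q : D (p - q) = D p - D q by rewrite mderivB mevalB.
have DM p q : D (p * q) = D p * q.@[v] + p.@[v] * D q by rewrite mderivM mevalD !mevalM.
have DZ c p : D (c *: p) = c * D p by rewrite mderivZ mevalZ.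
have DMX l l' : D (U l * U l') = d l * u l' + u l * d l' by rewrite DM !DX !EX.
have D4 (a b c e : R) (p q r s : {mpoly R[5]}) :
    D (a *: p + b *: q + c *: r + e *: s) = a * D p + b * D q + c * D r + e * D s.
  by rewrite 3!DD 4!DZ.
have E4 (a b c e : R) (p q r s : {mpoly R[5]}) :
    (a *: p + b *: q + c *: r + e *: s).@[v] = a * p.@[v] + b * q.@[v] + c * r.@[v] + e * s.@[v].
  by rewrite 3!mevalD 4!mevalZ.
have D7 (a b c e a' b' c' : R) (p q r s p' q' r' : {mpoly R[5]}) :
    D (a *: p + b *: q + c *: r + e *: s + a' *: p' + b' *: q' + c' *: r') =
    a * D p + b * D q + c * D r + e * D s + a' * D p' + b' * D q' + c' * D r'.
  by rewrite 6!DD 7!DZ.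
split.
- by rewrite -!DMX -DB.
- by rewrite -!DMX -DB.
- by rewrite -!DMX -DB.
have e : D (U 4 * U 4 + cubic_form h * U 4 + sextic_form f) =
    D (U 4 * U 4) + (D (cubic_form h) * (U 4).@[v] + (cubic_form h).@[v] * D (U 4))
    + D (sextic_form f).
  by rewrite 2!DD [D (cubic_form h * _)]DM.
by rewrite [LHS]e /cubic_form /sextic_form D4 E4 D7 !DMX !DX !EX.
Qed.

End Derivatives.

(** The cone over the twisted cubic has codimension two but three equations, so the rows of the
    Jacobian at a point of the curve are related. The relation bounds the rank above, three
    independent rows bound it below. *)
Lemma mxrank_eq3 (K : fieldType) n (M : 'M[K]_(4, n)) (r : 3.-tuple 'I_4) (c : 'I_4 -> K) :
  (forall a0 a1 a2, (forall j, a0 * M (tnth r 0) j + a1 * M (tnth r 1) j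
     + a2 * M (tnth r 2) j = 0) -> [/\ a0 = 0, a1 = 0 & a2 = 0]) ->
  (exists l, c l != 0) -> (forall j, \sum_l c l * M l j = 0) ->
  \rank M = 3%N.
Proof.
move=> indep [l cl] cM; apply/eqP; rewrite eqn_leq; apply/andP; split.
  rewrite -ltnS ltn_neqAle rank_leq_row andbT.
  apply: contra cl => Mfree; apply/eqP.
  have /eqP : \row_l c l *m M = 0.
    by apply/rowP => j; rewrite !mxE -[RHS](cM j); apply: eq_bigr => m _; rewrite mxE.
  by rewrite mulmx_free_eq0 // => /eqP/rowP/(_ l); rewrite !mxE.
have /eqP rk : row_free (rowsub (tnth r) M).
  apply: inj_row_free => a /rowP aM.
  have [j|a0 a1 a2] := indep (a 0 0) (a 0 1) (a 0 2).
    by move: (aM j); rewrite !mxE !big_ord_recl big_ord0 !mxE addr0 addrA;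
       congr (_ + _ + _ = _); congr (a _ _ * M (tnth r _) j); apply: val_inj.
  apply/rowP => -[[|[|[|//]]] lt_m]; rewrite mxE.
  - by rewrite -a0; congr (a _ _); apply: val_inj.
  - by rewrite -a1; congr (a _ _); apply: val_inj.
  by rewrite -a2; congr (a _ _); apply: val_inj.
by rewrite -[X in (X <= _)%N]rk; exact/mxrankS/rowsub_sub.
Qed.

Section Smoothness.
Variables (K : closedFieldType) (h f : {poly K}).
Hypothesis char2 : 2%N \in [pchar K].
Hypothesis hom : {in curve_eqs h f, forall q, q \is homog mdeg}.
Hypotheses (sh : (size h <= 4)%N) (sf : (size f <= 7)%N).

(* The curve y ^+ 2 + h y + f = 0 is singular above a zero of h exactly when
   the derivative y h' + f', whose square is f h' ^+ 2 + f' ^+ 2, vanishes. *)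
Definition smooth_pair :=
  (forall x, h.[x] = 0 -> f.[x] * h^`().[x] ^+ 2 + f^`().[x] ^+ 2 != 0) /\
  (h`_3 = 0 -> f`_6 * h`_2 ^+ 2 + f`_5 ^+ 2 != 0).

Let X := ProjectiveScheme hom.


Lemma horner_cubic x : h.[x] = h`_0 + h`_1 * x + h`_2 * x ^+ 2 + h`_3 * x ^+ 3.
Proof. by rewrite (horner_coef_wide _ sh) !big_ord_recl big_ord0 /bump /=; ring. Qed.

Lemma horner_sextic x : f.[x] = f`_0 + f`_1 * x + f`_2 * x ^+ 2 + f`_3 * x ^+ 3
  + f`_4 * x ^+ 4 + f`_5 * x ^+ 5 + f`_6 * x ^+ 6.
Proof. by rewrite (horner_coef_wide _ sf) !big_ord_recl big_ord0 /bump /=; ring. Qed.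

Let two0 : 2%:R = 0 :> K. Proof. exact: pcharf0. Qed.

Lemma horner_deriv_cubic x : h^`().[x] = h`_1 + h`_3 * x ^+ 2.
Proof.
have sd : (size h^`() <= 3)%N by rewrite (leq_trans (size_poly _ _)) //; case: (size h) sh.
rewrite (horner_coef_wide _ sd) !big_ord_recl big_ord0 /= !coef_deriv /bump /=.
by transitivity (h`_1 + h`_3 * x ^+ 2 + 2%:R * (h`_2 * x + h`_3 * x ^+ 2));
  [ring | rewrite two0 mul0r addr0].
Qed.

Lemma horner_deriv_sextic x : f^`().[x] = f`_1 + f`_3 * x ^+ 2 + f`_5 * x ^+ 4.
Proof.
have sd : (size f^`() <= 6)%N by rewrite (leq_trans (size_poly _ _)) //; case: (size f) sf.
rewrite (horner_coef_wide _ sd) !big_ord_recl big_ord0 /= !coef_deriv /bump /=.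
by transitivity (f`_1 + f`_3 * x ^+ 2 + f`_5 * x ^+ 4 + 2%:R * (f`_2 * x + f`_3 * x ^+ 2
  + 2%:R * f`_4 * x ^+ 3 + 2%:R * f`_5 * x ^+ 4 + 3%:R * f`_6 * x ^+ 5));
  [ring | rewrite two0 mul0r addr0].
Qed.

(** In the chart at infinity the coefficients are reversed: those of [h] of index three and two play
    the roles of h(0) and h'(0), those of [f] of index six and five the roles of f(0) and f'(0). The
    two halves of [smooth_pair] thus serve the points with first coordinate nonzero and zero. *)
Lemma smooth_curve : smooth_pair -> smooth_scheme X 1.
Proof.
case=> smooth_aff smooth_inf v [[l0 vl0]] /vanishes_at_curveP [].
set u : nat -> K := fun l => v (inord l); rewrite -!/(u _).
move=> q0 q1 q2; rewrite /= => q3.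
suff /eqP rk3 : \rank (jacobian (X := X) v) == 3%N by rewrite rk3.
have inordE (a b : nat) : (a < 5)%N -> (b < 5)%N -> (inord a == inord b :> 'I_5) = (a == b).
  by move=> a5 b5; rewrite -val_eqE /= !inordK.
have [u0|u0] := eqVneq (u 0%N) 0.
  (* With first coordinate zero, the minors leave only (0 : 0 : 0 : 1 : y) up to scaling. *)
  have u1 : u 1%N = 0 by apply/eqP; rewrite -sqrf_eq0 expr2 -q0 u0 mul0r.
  have u2 : u 2%N = 0 by apply/eqP; rewrite -sqrf_eq0 expr2 -q1 u1 mul0r.
  have u3 : u 3%N != 0.
    apply: contra vl0 => /eqP u3; rewrite u0 u1 u2 u3 !(mulr0, mul0r, addr0) in q3.
    have u4 : u 4%N = 0 by apply/eqP; rewrite -sqrf_eq0 expr2 q3.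
    rewrite -[l0]inord_val; move: (l0 : 'I_5) => [[|[|[|[|[|//]]]]] lt_l] /=; apply/eqP;
      first [exact: u0 | exact: u1 | exact: u2 | exact: u3 | exact: u4].
  apply/eqP.
  (* Here the gradient of the first minor is zero, which is the relation. *)
  pose c (l : 'I_4) : K := (l == 0)%:R.
  apply: (@mxrank_eq3 _ _ _ [tuple inord 1; inord 2; inord 3] c).
  - move=> a0 a1 a2; rewrite !(tnth_nth ord0) /= => eqs.
    have E j : a0 * ((curve_eqs h f)`_1)^`M(inord j).@[v]
     + a1 * ((curve_eqs h f)`_2)^`M(inord j).@[v]
     + a2 * ((curve_eqs h f)`_3)^`M(inord j).@[v] = 0.
      by move: (eqs (inord j)); rewrite !mxE !inordK.
    move: (E 0%N) (E 1%N) (E 2%N) (E 4%N) => {E eqs}.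
    have [_ -> -> ->] := deriv_curve_eqs h f v (inord 0).
    have [_ -> -> ->] := deriv_curve_eqs h f v (inord 1).
    have [_ -> -> ->] := deriv_curve_eqs h f v (inord 2).
    have [_ -> -> ->] := deriv_curve_eqs h f v (inord 4).
    rewrite !inordE //= -!/(u _).
    rewrite u0 u1 u2 !(mulr0, mul0r, addr0, add0r, mulr1, mul1r, subr0, oppr0).
    move=> E0 E1 E2 E4.
    have a20 : a2 = 0.
      apply/eqP; apply: contraT => a2n.
      move/eqP: E4; rewrite (addrr_pchar2 char2) add0r !mulf_eq0 (negPf a2n) (negPf u3) orbF /=.
      move/eqP => h30; move/eqP: E2; rewrite mulf_eq0 (negPf a2n) /= => /eqP e2.
      have := smooth_inf h30; rewrite -(mulrI_eq0 _ (mulfI u3)) -(mulrI_eq0 _ (mulfI u3)).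
      rewrite u0 u1 u2 h30 !(mulr0, mul0r, addr0, add0r) in q3.
      suff -> : u 3%N * (u 3%N * (f`_6 * h`_2 ^+ 2 + f`_5 ^+ 2)) =
        h`_2 ^+ 2 * (u 4%N * u 4%N + f`_6 * (u 3%N * u 3%N))
        + (h`_2 * u 4%N + f`_5 * u 3%N) * (f`_5 * u 3%N - h`_2 * u 4%N).
        by rewrite q3 e2 mul0r mulr0 addr0 eqxx.
      by ring.
    rewrite a20 !mul0r !addr0 in E0 E1.
    by split=> //; apply: (mulIf u3); rewrite mul0r.
  - by exists 0; rewrite /c eqxx oner_neq0.
  move=> j; rewrite !big_ord_recl big_ord0 !mxE /c.
  have [-> _ _ _] := deriv_curve_eqs h f v j; rewrite -!/(u _) u0 u1 u2.
  by rewrite !(mulr0, mul0r, addr0, subr0, oppr0).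
apply/eqP.
(* With Q0, Q1, Q2 the minors in the order of [curve_eqs], this is the syzygy U2 Q0 + U0 Q1 - U1 Q2
   = 0, differentiated at a common zero. *)
pose c (l : 'I_4) : K := nth 0 [:: u 2%N; u 0%N; - u 1%N; 0] l.
apply: (@mxrank_eq3 _ _ _ [tuple inord 0; inord 2; inord 3] c).
- move=> a0 a1 a2; rewrite !(tnth_nth ord0) /= => eqs.
  have E j : a0 * ((curve_eqs h f)`_0)^`M(inord j).@[v]
   + a1 * ((curve_eqs h f)`_2)^`M(inord j).@[v]
   + a2 * ((curve_eqs h f)`_3)^`M(inord j).@[v] = 0.
    by move: (eqs (inord j)); rewrite !mxE !inordK.
  move: (E 1%N) (E 2%N) (E 3%N) (E 4%N) => {E eqs}.
  have [-> _ -> ->] := deriv_curve_eqs h f v (inord 1).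
  have [-> _ -> ->] := deriv_curve_eqs h f v (inord 2).
  have [-> _ -> ->] := deriv_curve_eqs h f v (inord 3).
  have [-> _ -> ->] := deriv_curve_eqs h f v (inord 4).
  rewrite !inordE //= -!/(u _).
  rewrite !(mulr0, mul0r, addr0, add0r, mulr1, mul1r, subr0, sub0r).
  pose x := u 1%N / u 0%N; pose y := u 4%N / u 0%N.
  have e1 : u 1%N = u 0%N * x by rewrite mulrC divfK.
  have e4 : u 4%N = u 0%N * y by rewrite mulrC divfK.
  have e2 : u 2%N = u 0%N * x ^+ 2 by apply: (mulfI u0); rewrite q0 e1; ring.
  have e3 : u 3%N = u 0%N * x ^+ 3 by apply: (mulfI u0); rewrite q2 e1 e2; ring.
  rewrite e1 e2 e3 e4 => E1 E2 E3 E4.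
  have dbl (z : K) : z + z = 0 by exact: addrr_pchar2.
  have a20 : a2 = 0.
    apply/eqP; apply: contraT => a2n.
    have hx : h.[x] = 0.
      rewrite horner_cubic; apply: (mulfI u0); apply: (mulfI a2n); rewrite !mulr0 -[RHS]E4 dbl.
      ring.
    have fx : f.[x] = - y ^+ 2.
      apply: (mulfI u0); apply: (mulfI u0); apply/eqP; rewrite -subr_eq0; apply/eqP.
      have := hx; rewrite horner_cubic => hx'.
      transitivity (u 4%N * u 4%N
        + u 0%N * (h`_0 + h`_1 * x + h`_2 * x ^+ 2 + h`_3 * x ^+ 3) * u 4%N
        + u 0%N * (u 0%N * f.[x])); first by rewrite hx' e4; ring.
      by rewrite -[RHS]q3 e1 e2 e3 e4 horner_sextic; ring.
    have dx : y * h^`().[x] + f^`().[x] = 0.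
      rewrite horner_deriv_cubic horner_deriv_sextic.
      rewrite !dbl !(mulr0, addr0, oppr0, add0r) in E1 E3.
      apply: (mulfI u0); apply: (mulfI a2n); rewrite !mulr0.
      (* In characteristic two the tangent vector to (1, x, x^2, x^3) is (0, 1, 0, x^2); it kills
         the gradients of the minors and leaves the derivative of the last quadric. *)
      have := congr2 (fun p q => p + x ^+ 2 * q) E1 E3; rewrite /= mulr0 addr0.
      by apply: etrans; ring.
    have := smooth_aff x hx; suff -> : f.[x] * h^`().[x] ^+ 2 + f^`().[x] ^+ 2
      = (y * h^`().[x] + f^`().[x]) * (f^`().[x] - y * h^`().[x]) by rewrite dx mul0r eqxx.
    by rewrite fx; ring.
  rewrite a20 !mul0r !addr0 in E2 E3; rewrite oppr0 mulr0 add0r in E3.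
  have a10 : a1 = 0 by apply: (mulIf u0); rewrite mul0r.
  rewrite a10 mul0r addr0 in E2.
  by split=> //; apply: (mulIf u0); rewrite mul0r.
- by exists (inord 1); rewrite /c inordK.
move=> j; rewrite !big_ord_recl big_ord0 !mxE /c.
have [D0 D1 D2 _] := deriv_curve_eqs h f v j.
rewrite [(peqs X)`_ord0]/((curve_eqs h f)`_0).
rewrite [(peqs X)`_(lift ord0 ord0)]/((curve_eqs h f)`_1).
rewrite [(peqs X)`_(lift ord0 (lift ord0 ord0))]/((curve_eqs h f)`_2).
rewrite D0 D1 D2 [nth _ _ ord0]/= [nth _ _ (lift ord0 ord0)]/=.
rewrite [nth _ _ (lift ord0 (lift ord0 ord0))]/=.
rewrite [nth _ _ (lift ord0 (lift ord0 (lift ord0 ord0)))]/=.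
rewrite -!/(u _) mul0r !addr0.
transitivity ((inord 0 == j)%:R * (u 2%N * u 2%N - u 1%N * u 3%N)
  + (inord 1 == j)%:R * (u 0%N * u 3%N - u 1%N * u 2%N)
  + (inord 2 == j)%:R * (u 1%N * u 1%N - u 0%N * u 2%N)); last first.
  by rewrite q0 q1 q2 !subrr !mulr0 !addr0.
ring.
Qed.
End Smoothness.

(* At a zero of h the section y = g would make the curve singular, and if h is
   constant the singularity is at infinity. *)
Lemma smooth_pair_no_section (K : closedFieldType) (h f g : {poly K}) :
  2%N \in [pchar K] -> (size f <= 7)%N -> smooth_pair h f -> g ^+ 2 + h * g + f != 0.
Proof.
move=> char2 sf [smooth_aff smooth_inf]; apply/eqP => e.
have ef : f = - (g ^+ 2 + h * g) by apply/eqP; rewrite -addr_eq0 addrC e.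
have two0 : 2%:R = 0 :> K by exact: pcharf0.
have [sh|/closed_rootP[x /rootP hx]] := eqVneq (size h) 1%N; last first.
  have := smooth_aff x hx; rewrite ef expr2 !derivE !hornerRE hx.
  suff -> : - (g.[x] * g.[x] + 0 * g.[x]) * h^`().[x] ^+ 2
    + (- (g^`().[x] * g.[x] + g.[x] * g^`().[x] + (h^`().[x] * g.[x] + 0 * g^`().[x]))) ^+ 2
    = 2%:R * (2%:R * g.[x] ^+ 2 * g^`().[x] ^+ 2 + 2%:R * g.[x] ^+ 2 * g^`().[x] * h^`().[x]).
    by rewrite two0 mul0r eqxx.
  by ring.
have /eqP/size_poly1P[c c0 eh] := sh.
have := smooth_inf; rewrite eh !coefC /= => /(_ erefl).
rewrite expr0n /= mulr0 add0r sqrf_eq0 => /eqP; apply.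
(* A section of degree above three would push the degree of [f] above six. With degree at most
   three, the coefficient of index five in g^2 is twice a product, hence zero, against the condition
   at infinity. *)
have sg : (size g <= 4)%N.
  rewrite leqNgt; apply/negP => sg.
  have g0 : g != 0 by rewrite -size_poly_gt0 (leq_trans _ sg).
  have s2 : size (g * g) = (size g + size g).-1 by rewrite size_mul.
  have s1 : (size (c%:P * g)%R <= size g)%N by rewrite mul_polyC size_scale_leq.
  have s12 : (size (c%:P * g)%R < size (g * g)%R)%N by rewrite s2; lia.
  by move: sf; rewrite ef eh expr2 size_polyN (size_polyDl s12) s2; lia.
rewrite ef eh coefN coefD coefCM expr2 coefM !big_ord_recl big_ord0 /bump /=.
rewrite [g`_4]nth_default // [g`_5]nth_default ?(leq_trans sg) //.
transitivity (- 2%:R * (g`_2 * g`_3)); last by rewrite two0 oppr0 mul0r.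
by ring.
Qed.

(** * Compatibility with base change *)

Section BaseChange.
Variables (k K : fieldType) (iota : {rmorphism k -> K}) (h f : {poly k}).

Lemma map_curve_eqs :
  map (map_mpoly iota) (curve_eqs h f) = curve_eqs (map_poly iota h) (map_poly iota f).
Proof.
have MX j : map_mpoly iota (U j) = U j by exact: map_mpolyX.
have MM p q : map_mpoly iota (p * q : {mpoly k[5]}) = map_mpoly iota p * map_mpoly iota q.
  exact: rmorphM.
have MD p q : map_mpoly iota (p + q : {mpoly k[5]}) = map_mpoly iota p + map_mpoly iota q.
  exact: rmorphD.
have MB p q : map_mpoly iota (p - q : {mpoly k[5]}) = map_mpoly iota p - map_mpoly iota q.
  exact: rmorphB.
have MZ c p : map_mpoly iota (c *: p : {mpoly k[5]}) = iota c *: map_mpoly iota p.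
  exact: map_mpolyZ.
have M4 (a b c e : k) (p q r s : {mpoly k[5]}) :
    map_mpoly iota (a *: p + b *: q + c *: r + e *: s) =
    iota a *: map_mpoly iota p + iota b *: map_mpoly iota q + iota c *: map_mpoly iota r
    + iota e *: map_mpoly iota s by rewrite 3!MD 4!MZ.
have M7 (a b c e a' b' c' : k) (p q r s p' q' r' : {mpoly k[5]}) :
    map_mpoly iota (a *: p + b *: q + c *: r + e *: s + a' *: p' + b' *: q' + c' *: r') =
    iota a *: map_mpoly iota p + iota b *: map_mpoly iota q + iota c *: map_mpoly iota r
    + iota e *: map_mpoly iota s + iota a' *: map_mpoly iota p' + iota b' *: map_mpoly iota q'
    + iota c' *: map_mpoly iota r' by rewrite 6!MD 7!MZ.
rewrite /curve_eqs /= !MB; congr [:: _; _; _; _]; try by rewrite !MM !MX.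
rewrite 2!MD 2!MM !MX /cubic_form /sextic_form M4 M7 !MM !MX.
by rewrite !coef_map.
Qed.

(** The record contains a homogeneity proof, so the base change is identified only up to some [hom];
    this is why the geometric lemmas accept an arbitrary one. *)
Lemma base_change_curve : exists hom,
  base_change iota (ProjectiveScheme (@curve_eqs_homog k h f)) =
  ProjectiveScheme (peqs := curve_eqs (map_poly iota h) (map_poly iota f)) hom.
Proof.
have cast (s t : seq {mpoly K[5]}) (hs : {in s, forall q, q \is homog mdeg}) :
    s = t -> exists ht, ProjectiveScheme hs = ProjectiveScheme (peqs := t) ht.
  by move=> est; case: t / est; exists hs.
exact: cast map_curve_eqs.
Qed.

End BaseChange.

(** * Changes of coordinates in the function field *)

Section GenericPairs.
Variables (K : fieldType) (L : fieldType) (i : {rmorphism K -> L}).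

Definition generic_pair x y := free_pair i x y /\ generating_pair i x y.

Lemma generated_horner (P : L -> Prop) x (A : {poly K}) :
  (forall c, P (i c)) -> P x -> (forall u v, P u -> P v -> P (u + v)) ->
  (forall u v, P u -> P v -> P (u * v)) -> P (map_poly i A).[x].
Proof.
move=> Pc Px PD PM; elim/poly_ind: A => [|A c IH].
  by rewrite rmorph0 horner0 -(rmorph0 i).
rewrite rmorphD rmorphM /= map_polyX map_polyC !hornerRE.
by apply: PD; [apply: PM | apply: Pc].
Qed.

(** This passes from y^2 + h y + h g = 0 to the Artin-Schreier form z^2 + z + g / h = 0 without
    changing the field. *)
Lemma generic_pair_scale x y (h : {poly K}) :
  h != 0 -> generic_pair x y -> generic_pair x (y / (map_poly i h).[x]).
Proof.
move=> h0 [xy_free xy_gen]; have hx := free_horner_neq0 xy_free h0; split.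
  move=> A B eAB; have [|] := @xy_free (A * h) B.
    rewrite rmorphM hornerM /= -[RHS](mul0r (map_poly i h).[x]) -eAB mulrDl.
    by rewrite mulrA divfK.
  by move=> /eqP; rewrite mulf_eq0 (negPf h0) orbF => /eqP.
move=> P Pc Px Py PD PM PV; apply: xy_gen => //.
by rewrite -[y](divfK hx); apply: (PM) => //; apply: generated_horner.
Qed.

Lemma generic_pair_translate x y t : generic_pair x y -> generic_pair x (y + i t).
Proof.
move=> [xy_free xy_gen]; split.
  move=> A B eAB; have [|] := @xy_free (A + t *: B) B.
    rewrite rmorphD /= map_polyZ hornerD hornerZ -[RHS]eAB; ring.
  by move=> + B0; rewrite B0 scaler0 addr0.
move=> P Pc Px Py PD PM PV; apply: xy_gen => //.
by rewrite -[y](addrK (i t)) -rmorphN; apply: PD.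
Qed.

End GenericPairs.

Section Homography.
Variables (K : closedFieldType) (L : fieldType) (i : {rmorphism K -> L}).
Variables (x y : L) (a b c d : K).
Hypotheses (det0 : a * d - b * c != 0) (xy_generic : generic_pair i x y).

Let den := i c * x + i d.
Let z := (i a * x + i b) / den.

Lemma linear_neq0 p q : (p != 0) || (q != 0) -> i p * x + i q != 0.
Proof.
move=> pq; have := @free_horner_neq0 _ _ i _ _ (p *: 'X + q%:P) xy_generic.1.
rewrite rmorphD /= map_polyZ map_polyX map_polyC !hornerRE; apply.
apply: contraTneq pq => e; rewrite negb_or !negbK.
have := congr1 (fun A : {poly K} => (A`_0, A`_1)) e.
rewrite !coefE /= mulr0 mulr1 add0r addr0 => -[-> ->]; by rewrite eqxx.
Qed.

Lemma homography_den : den != 0.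
Proof.
apply: linear_neq0; apply: contraNT det0; rewrite negb_or !negbK => /andP[/eqP-> /eqP->].
by rewrite !mulr0 subrr.
Qed.

(** Transcendence of [z]: over the closed field [A] splits, and each factor z - t is a quotient of
    nonzero linear polynomials in [x]. *)
Lemma homography_horner_neq0 (A : {poly K}) : A != 0 -> (map_poly i A).[z] != 0.
Proof.
move=> A0; have [r ->] := closed_field_poly_normal A.
rewrite map_polyZ /= hornerZ mulf_neq0 ?fmorph_eq0 ?lead_coef_eq0 //.
rewrite rmorph_prod /= horner_prod prodf_seq_neq0; apply/allP => t _.
rewrite rmorphB /= map_polyX map_polyC !hornerRE.
have -> : z - i t = (i (a - t * c) * x + i (b - t * d)) / den.
  apply: (mulIf homography_den); rewrite mulrBl !divfK ?homography_den //.
  by rewrite !(rmorphB, rmorphM) /den /=; ring.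
rewrite mulf_neq0 ?invr_eq0 ?homography_den // linear_neq0 //.
apply: contraNT det0; rewrite negb_or !negbK !subr_eq0 => /andP[/eqP-> /eqP->].
by apply/eqP; ring.
Qed.

Lemma horner_linear p q : (map_poly i (p *: 'X + q%:P)).[x] = i p * x + i q.
Proof. by rewrite rmorphD /= map_polyZ map_polyX map_polyC !hornerRE. Qed.

Lemma homography_clear (A : {poly K}) : exists (B : {poly K}) n,
  (map_poly i A).[z] * den ^+ n = (map_poly i B).[x].
Proof.
elim/poly_ind: A => [|A t [B [n IH]]].
  by exists 0, 0%N; rewrite !rmorph0 !horner0 mul0r.
exists (B * (a *: 'X + b%:P) + t *: (c *: 'X + d%:P) ^+ n.+1), n.+1.
rewrite rmorphD rmorphM /= map_polyX map_polyC !hornerRE.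
rewrite [in RHS]rmorphD hornerD [in RHS]rmorphM hornerM horner_linear /= map_polyZ hornerZ.
rewrite rmorphXn horner_exp horner_linear -/den -IH.
have -> : i a * x + i b = z * den by rewrite divfK ?homography_den.
by rewrite exprS; ring.
Qed.

Lemma generic_pair_homography : generic_pair i z y.
Proof.
have [xy_free xy_gen] := xy_generic; split.
  move=> A B eAB.
  have [A' [m eA]] := homography_clear A; have [B' [n eB]] := homography_clear B.
  have dn m' : den ^+ m' != 0 by rewrite expf_neq0 ?homography_den.
  have denE := horner_linear c d; rewrite -/den in denE.
  have [|_] := @xy_free (A' * (c *: 'X + d%:P) ^+ n) (B' * (c *: 'X + d%:P) ^+ m).
    rewrite 2!rmorphM 2!rmorphXn !(hornerM, horner_exp) denE -eA -eB.
    transitivity (((map_poly i A).[z] + (map_poly i B).[z] * y) * den ^+ m * den ^+ n).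
      ring.
    by rewrite eAB !mul0r.
  move/(congr1 (fun q => (map_poly i q).[x])).
  rewrite rmorphM rmorphXn hornerM horner_exp denE rmorph0 horner0 -eB => /eqP.
  rewrite !mulf_eq0 !(negPf (dn _)) !orbF => B0.
  have {}B0 : B = 0 by apply/eqP; apply: contraTT B0; exact: homography_horner_neq0.
  split=> //; apply/eqP; move: eAB; rewrite B0 rmorph0 horner0 mul0r addr0 => /eqP.
  by apply: contraTT; exact: homography_horner_neq0.
move=> P Pc Pz Py PD PM PV; apply: xy_gen => //.
have D0 : i a - i c * z != 0.
  have -> : i a - i c * z = i (a * d - b * c) / den.
    apply: (mulIf homography_den); rewrite mulrBl divfK ?homography_den //.
    rewrite -mulrA divfK ?homography_den // /den !(rmorphB, rmorphM) /=; ring.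
  by rewrite mulf_neq0 ?invr_eq0 ?homography_den // fmorph_eq0.
(* The inverse homography, given by the adjugate matrix. *)
have -> : x = (i d * z + i (- b)) / (i a + i (- c) * z).
  rewrite !rmorphN mulNr; apply: (mulIf D0); rewrite divfK //.
  apply: (mulIf homography_den).
  have ez : z * den = i a * x + i b by rewrite divfK ?homography_den.
  transitivity (x * (i a * den - i c * (z * den))); first by ring.
  transitivity (i d * (z * den) - i b * den); last by ring.
  by rewrite ez /den; ring.
by apply: (PM); [apply: (PD) => //; apply: (PM) | apply: PV; apply: (PD) => //; apply: (PM)].
Qed.

End Homography.

(** * From function fields to smooth projective models *)

Lemma affine_function_field_plane (K : closedFieldType) (L : fieldType)
    (i : {rmorphism K -> L}) (s eta phi : {poly K}) (x y : L) (E : ('I_2 -> K) -> Prop) :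
  s != 0 -> generic_pair i x y -> on_plane_curve s eta phi i x y ->
  (forall v, E v <-> s.[v ord0] != 0 /\
     s.[v ord0] * v ord_max ^+ 2 + eta.[v ord0] * v ord_max + phi.[v ord0] = 0) ->
  affine_function_field E i.
Proof.
move=> s0 [xy_free xy_gen] xy_on EP.
pose w (j : 'I_2) := if j == ord0 then x else y.
exists w; split=> [p|].
  rewrite (@plane_curve_vanishing K L i s eta phi w s0 xy_free xy_on p).
  by split=> vp v; [case/EP; exact: vp | move=> sv ev; apply: vp; apply/EP].
apply: xy_gen => [c|||u v [p [q [q0 ->]]] [r [t [t0 ->]]]
    |u v [p [q [q0 ->]]] [r [t [t0 ->]]]|u [p [q [q0 ->]]]].
- exists c%:MP, 1%:MP; rewrite !map_mevalC rmorph1 divr1; split=> //.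
  exact: oner_neq0.
- exists 'X_ord0, 1%:MP; rewrite map_mevalC map_mevalX rmorph1 divr1; split=> //.
  exact: oner_neq0.
- exists 'X_ord_max, 1%:MP; rewrite map_mevalC map_mevalX rmorph1 divr1; split=> //.
  exact: oner_neq0.
- exists (p * t + r * q), (q * t).
  rewrite [in X in _ /\ X]map_mevalD !map_mevalM mulf_neq0 //; split=> //.
  exact: addf_div.
- exists (p * r), (q * t).
  rewrite !map_mevalM mulf_neq0 //; split=> //; exact: mulf_div.
have [p0|p0] := eqVneq (map_mpoly i p).@[w] 0.
  by exists p, q; split=> //; rewrite p0 mul0r invr0.
by exists q, p; split=> //; rewrite invf_div.
Qed.

(** At a zero of [h] both h g and h g' vanish, so the smoothness expression reduces to the square of
    h' g. *)
Lemma smooth_pair_mul (K : closedFieldType) (h g : {poly K}) :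
  (forall x, h.[x] = 0 -> h^`().[x] != 0 /\ g.[x] != 0) ->
  (h`_3 = 0 -> (h * g)`_6 * h`_2 ^+ 2 + (h * g)`_5 ^+ 2 != 0) ->
  smooth_pair h (h * g).
Proof.
move=> H Hinf; split=> // x hx; have [h'x gx] := H x hx.
rewrite derivM !hornerRE hx !mul0r add0r addr0 sqrf_eq0; exact: mulf_neq0.
Qed.

(** Each type is reduced to a choice of [h] and [g] over [k]. The last clause is left open in [E]:
    it remains to recognize the affine curve of the type inside the same field [L]. *)
Lemma hyperelliptic_curve (k : fieldType) (K : closedFieldType)
    (iota : {rmorphism k -> K}) (h g : {poly k}) :
  2%N \in [pchar K] -> (size h <= 4)%N -> (size (h * g)%R <= 7)%N -> h != 0 ->
  smooth_pair (map_poly iota h) (map_poly iota h * map_poly iota g) ->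
  exists C : projective_scheme k, genus_two_curve iota C /\
  exists (L : fieldType) (i : {rmorphism K -> L}) (x y : L),
    [/\ generic_pair i x y,
        on_plane_curve (map_poly iota h) (map_poly iota h) (map_poly iota g) i x y &
        forall n (E : ('I_n -> K) -> Prop), affine_function_field E i ->
          smooth_projective_model E (base_change iota C)].
Proof.
move=> char2 sh sf h0 smooth; pose f := h * g.
pose H := map_poly iota h; pose G := map_poly iota g; pose F := map_poly iota f.
have FE : F = H * G by rewrite /F rmorphM.
have sH : (size H <= 4)%N by rewrite size_map_poly.
have sF : (size F <= 7)%N by rewrite size_map_poly.
have H0 : H != 0 by rewrite map_poly_eq0.
rewrite -FE in smooth.
have [L [i [x [y [xy_on xy_free xy_gen]]]]] :=
  function_field_exists (fun q => smooth_pair_no_section q char2 sF smooth).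
pose C := ProjectiveScheme (@curve_eqs_homog k h f).
have [hom CE] := base_change_curve iota h f.
have curve : smooth_projective_curve (base_change iota C).
  rewrite CE; split; first exact: (irreducible_curve hom sH sF xy_free xy_on).
    exact: (dimension_curve hom sH sF xy_free xy_on).
  exact: (smooth_curve char2 sH sF smooth).
exists C; split.
  (* The genus is that of the curve over [k], but the generic point over [K] still serves, through
     the composite embedding of [k] into [L]. *)
  split=> //; apply: (@genus_curve k h f _ L (i \o iota) x y) => //.
    move=> A B; rewrite !map_poly_comp => /xy_free[].
    by move=> /eqP + /eqP; rewrite !map_poly_eq0 => /eqP-> /eqP->.
  by rewrite !map_poly_comp.
exists L, i, x, (y / (map_poly i H).[x]); split.
- exact: generic_pair_scale.
- have Hx := free_horner_neq0 xy_free H0; rewrite /on_plane_curve -/G.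
  apply: (mulIf Hx); rewrite mul0r -[RHS]xy_on FE rmorphM hornerM /=.
  have ey := divfK Hx y; move: ey; set z := y / _; set e := (map_poly i H).[x] => <-.
  ring.
move=> n E EL; split=> //; exists L, i; split=> //.
by rewrite CE; exact: (projective_function_field_curve hom sH sF xy_free xy_on xy_gen).
Qed.

Lemma addr_eq0_pchar2 (R : nzRingType) (x y : R) :
  2%N \in [pchar R] -> x + y = 0 <-> x = y.
Proof.
by move=> char2; rewrite -{1}(oppr_pchar2 char2 y); split=> [/subr0_eq|->] //; rewrite subrr.
Qed.

Lemma curve111P (K : closedFieldType) (a b c : K) (v : 'I_2 -> K) : 2%N \in [pchar K] ->
  let s : {poly K} := 'X^2 + 'X in
  curve111 a b c v <-> s.[v ord0] != 0 /\
    s.[v ord0] * v ord_max ^+ 2 + s.[v ord0] * v ord_max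
    + (a *: 'X^3 + a *: 'X^2 + (b + c) *: 'X + b%:P).[v ord0] = 0.
Proof.
move=> char2 s; rewrite /s /curve111; set x := v ord0; set y := v ord_max.
have -> : ('X^2 + 'X).[x] = x * (x + 1) :> K by rewrite !hornerRE ?hornerXn; ring.
have cleared : x != 0 -> x + 1 != 0 ->
    (a *: 'X^3 + a *: 'X^2 + (b + c) *: 'X + b%:P).[x]
    = x * (x + 1) * (a * x + b / x + c / (x + 1)).
  by move=> x0 x1; rewrite !hornerRE ?hornerXn; field; rewrite x0 x1.
split=> [[x0 x1 e]|[]].
  rewrite cleared // mulf_neq0 // -!mulrDr e; split=> //.
  by rewrite (addrr_pchar2 char2) mulr0.
rewrite mulf_eq0 negb_or => /andP[x0 x1]; rewrite cleared // -!mulrDr => /eqP.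
by rewrite !mulf_eq0 (negPf x0) (negPf x1) /= => /eqP/(addr_eq0_pchar2 _ _ char2).
Qed.

(** In characteristic two [z] is the cross-ratio (x + b) (a + c) / ((x + a) (b + c)), which takes
    the values oo, 0, 1 at x = a, b, c; each term on the left therefore has a single simple pole. *)
Lemma homography_partial_fractions (L : fieldType) (a b c x : L) : 2%N \in [pchar L] ->
  [/\ a + b != 0, a + c != 0 & b + c != 0] -> [/\ x + a != 0, x + b != 0 & x + c != 0] ->
  let z := ((a + c) * x + b * (a + c)) / ((b + c) * x + a * (b + c)) in
  [/\ z != 0, z + 1 != 0 & a * z + b / z + c / (z + 1) =
    (a * ((a + b) * (a + c)) ^+ 2 * ((x + b) * (x + c))
     + b * ((a + b) * (b + c)) ^+ 2 * ((x + a) * (x + c))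
     + c * ((a + c) * (b + c)) ^+ 2 * ((x + a) * (x + b)))
    / ((a + b) * (b + c) * (a + c) * ((x + a) * (x + b) * (x + c)))
    + (a * (a + c) / (b + c) + b * (b + c) / (a + c) + c * (b + c) / (a + b))].
Proof.
move=> char2 [ab ac bc] [xa xb xc] z.
have two0 : 2%:R = 0 :> L by exact: pcharf0.
have zE : z = (x + b) * (a + c) / ((x + a) * (b + c)).
  by rewrite /z; congr (_ / _); ring.
have z1E : z + 1 = (a + b) * (x + c) / ((x + a) * (b + c)).
  have -> : (a + b) * (x + c) = (x + b) * (a + c) + (x + a) * (b + c) - 2%:R * (x * c + a * b).
    by ring.
  by rewrite two0 mul0r subr0 mulrDl divff ?mulf_neq0 // -zE.
(* The tactic [field] ignores the characteristic; it enters through these rewritings instead. *)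
have shift u v : x + u = (x + v) + (v + u).
  have -> : x + u = (x + v) + (v + u) - 2%:R * v by ring.
  by rewrite two0 mul0r subr0.
split; [by rewrite zE !mulf_neq0 ?invr_eq0 ?mulf_neq0
       | by rewrite z1E !mulf_neq0 ?invr_eq0 ?mulf_neq0 |].
(* Each term is its value at x = oo plus a simple pole; the three values add up to the constant. *)
have e1 : a * z = a * (a + c) / (b + c) + a * (a + c) * (a + b) / ((b + c) * (x + a)).
  by rewrite zE (shift b a); field; rewrite xa bc.
have e2 : b / z = b * (b + c) / (a + c) + b * (b + c) * (a + b) / ((a + c) * (x + b)).
  by rewrite zE (shift a b); field; rewrite -(shift a b) xa xb ac bc.
have e3 : c / (z + 1) = c * (b + c) / (a + b) + c * (b + c) * (a + c) / ((a + b) * (x + c)).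
  by rewrite z1E (shift a c); field; rewrite -(shift a c) xa xc ab bc.
rewrite e1 e2 e3; field; by rewrite xa xb xc ab ac bc.
Qed.

(* After the homography moving oo, 0, 1 to a, b, c, the right-hand side of the type
   (1,1,1) equation is, up to a constant, this polynomial divided by
   (a + b) (b + c) (a + c) (x + a) (x + b) (x + c). *)
Definition residue_poly (R : comNzRingType) (a b c : R) : {poly R} :=
  (a * ((a + b) * (a + c)) ^+ 2) *: (('X + b%:P) * ('X + c%:P))
  + (b * ((a + b) * (b + c)) ^+ 2) *: (('X + a%:P) * ('X + c%:P))
  + (c * ((a + c) * (b + c)) ^+ 2) *: (('X + a%:P) * ('X + b%:P)).

Lemma affine_function_field_curve111 (K : closedFieldType) (L : fieldType)
    (i : {rmorphism K -> L}) (a b c : K) (x y : L) :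
  2%N \in [pchar K] -> [/\ a + b != 0, a + c != 0 & b + c != 0] -> generic_pair i x y ->
  let h := ('X + a%:P) * ('X + b%:P) * ('X + c%:P) in
  on_plane_curve h h (((a + b) * (b + c) * (a + c))^-1 *: residue_poly a b c) i x y ->
  affine_function_field (curve111 a b c) i.
Proof.
move=> char2 [ab ac bc] xy_gen h xy_on.
have char2L : 2%N \in [pchar L] by exact: rmorph_pchar char2.
have lin u : (map_poly i ('X + u%:P)).[x] = x + i u.
  by rewrite rmorphD /= map_polyX map_polyC !hornerRE.
have xn u : x + i u != 0.
  rewrite -lin; apply: free_horner_neq0 xy_gen.1 _.
  by rewrite -[u]opprK polyCN polyXsubC_eq0.
have det0 : (a + c) * (a * (b + c)) - b * (a + c) * (b + c) != 0.
  have -> : (a + c) * (a * (b + c)) - b * (a + c) * (b + c) = (a - b) * (a + c) * (b + c).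
    by ring.
  by rewrite (oppr_pchar2 char2) !mulf_neq0.
set kappa := a * (a + c) / (b + c) + b * (b + c) / (a + c) + c * (b + c) / (a + b).
have [t et] := closed_quadratic 1 kappa (oner_neq0 K).
have zy_gen := generic_pair_translate t (generic_pair_homography det0 xy_gen).
have := @homography_partial_fractions L (i a) (i b) (i c) x char2L.
rewrite -!rmorphD -!rmorphM !fmorph_eq0 => /(_ (And3 ab ac bc) (And3 (xn a) (xn b) (xn c))).
cbv zeta; rewrite /= in zy_gen; set z := _ / _ in zy_gen *.
move=> [z0 z1]; set R := (_ + _ + _) / _ => ez.
have ek : i kappa = i (a * (a + c)) / i (b + c) + i (b * (b + c)) / i (a + c)
    + i (c * (b + c)) / i (a + b) by rewrite /kappa 2!(rmorphD i) 3!(fmorph_div i).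
rewrite -ek in ez.
have eR : y ^+ 2 + y + R = 0.
  have hx0 : (x + i a) * (x + i b) * (x + i c) != 0 by rewrite !mulf_neq0.
  have hE : (map_poly i h).[x] = (x + i a) * (x + i b) * (x + i c).
    by rewrite /h 2!rmorphM 2!hornerM !lin.
  have iM2 u q : i (u * q ^+ 2) = i u * i q ^+ 2 by rewrite rmorphM rmorphXn.
  have pM u v : (map_poly i (('X + u%:P) * ('X + v%:P))).[x] = (x + i u) * (x + i v).
    by rewrite rmorphM hornerM !lin.
  move: xy_on; rewrite /on_plane_curve hE map_polyZ hornerZ fmorphV => e.
  apply: (mulfI hx0); rewrite mulr0 -[RHS]e (mulrDr _ (_ + y)) (mulrDr _ (y ^+ 2)).
  congr (_ + _ + _).
  have pD p q : (map_poly i (p + q)).[x] = (map_poly i p).[x] + (map_poly i q).[x].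
    by rewrite rmorphD hornerD.
  have pZ u p : (map_poly i (u *: p)).[x] = i u * (map_poly i p).[x].
    by rewrite map_polyZ hornerZ.
  rewrite /residue_poly 2!pD 3!pZ 3!pM 3!iM2 /R.
  have cancel_h (u v w : L) : u != 0 -> u * (v / (w * u)) = w^-1 * v.
    by move=> u0; rewrite invfM mulrCA [u * _]mulrCA mulfV // mulr1 mulrC.
  exact: cancel_h.
have s0 : 'X^2 + 'X != 0 :> {poly K}.
  by apply/eqP => /(congr1 (fun q : {poly K} => q`_2)) /eqP; rewrite !coefE addr0 oner_eq0.
apply: (affine_function_field_plane s0 zy_gen _ (fun v => curve111P a b c v char2)).
rewrite /on_plane_curve !rmorphD /= !map_polyZ !map_polyXn map_polyX map_polyC rmorphD.
have -> : ('X^2 + 'X).[z] = z * (z + 1) by rewrite !hornerRE ?hornerXn; ring.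
have -> : (i a *: 'X^3 + i a *: 'X^2 + (i b + i c) *: 'X + (i b)%:P).[z]
    = z * (z + 1) * (i a * z + i b / z + i c / (z + 1)).
  by rewrite !hornerRE ?hornerXn; field; rewrite z0 z1.
rewrite ez.
(* In the square of y + t the cross term is a multiple of two, and t^2 + t absorbs the constant
   [kappa]. *)
transitivity (z * (z + 1) *
  ((y ^+ 2 + y + R) + i (1 * t ^+ 2 + 1 * t + kappa) + 2%:R * (y * i t))).
  by rewrite !(rmorphD, rmorphM, rmorphXn, rmorph1); ring.
by rewrite eR et rmorph0 (pcharf0 char2L) mul0r !addr0 mulr0.
Qed.

Lemma horner_modp_root (F : fieldType) (p q : {poly F}) x : root q x -> (p %% q).[x] = p.[x].
Proof.
by move=> /rootP qx; rewrite [in RHS](divp_eq p q) !hornerRE qx mulr0 add0r.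
Qed.

Lemma size_scaleXn_leq (R : nzRingType) (c : R) n m :
  (n < m)%N -> (size (c *: 'X^n) <= m)%N.
Proof.
by move=> lt_nm; rewrite (leq_trans (size_scale_leq _ _)) // size_polyXn.
Qed.

Lemma size_polyD_leq (R : nzRingType) (p q : {poly R}) m :
  (size p <= m)%N -> (size q <= m)%N -> (size (p + q)%R <= m)%N.
Proof. by move=> sp sq; rewrite (leq_trans (size_polyD _ _)) // geq_max sp sq. Qed.

(** * Realizing the j-invariants *)

Section Types.
Variables (k : fieldType) (K : closedFieldType) (iota : {rmorphism k -> K}).
Hypothesis char2 : 2%N \in [pchar K].

Lemma exists_curve5 (a c : k) : a != 0 ->
  exists C : projective_scheme k, genus_two_curve iota C /\
    j_invariant (base_change iota C) 0 0 (iota (c ^+ 5 / a ^+ 3)).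
Proof.
move=> a0; pose g := a *: 'X^5 + c *: 'X^3.
have gE : map_poly iota g = iota a *: 'X^5 + iota c *: 'X^3.
  by rewrite rmorphD /= !map_polyZ !map_polyXn.
have [|||| C [genus2 [L [i [x [y [xy_gen xy_on model]]]]]]] :=
  @hyperelliptic_curve k K iota 1 g char2.
- by rewrite size_poly1.
- by rewrite mul1r /g; apply: size_polyD_leq; apply: size_scaleXn_leq.
- exact: oner_neq0.
- rewrite rmorph1; apply: smooth_pair_mul => [x|_].
    by rewrite hornerC => /eqP; rewrite oner_eq0.
  (* [h] has no zero, and at infinity the condition reads a^2 != 0. *)
  rewrite mul1r gE !coefE /= !(mulr0, mulr1, addr0, add0r) ?mul0r ?expr0n /=.
  by rewrite ?add0r expf_neq0 // fmorph_eq0.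
exists C; split=> //; rewrite fmorph_div !rmorphXn.
apply: JType5; first by rewrite fmorph_eq0.
apply: model; rewrite rmorph1 in xy_on.
apply: (affine_function_field_plane (oner_neq0 _) xy_gen xy_on) => v.
rewrite hornerC oner_neq0 !mul1r gE !hornerRE ?hornerXn /curve5.
rewrite addr_eq0_pchar2 //; split=> [->//|[_ ->] //].
Qed.

Lemma exists_curve13 (a b c : k) : a * c != 0 ->
  exists C : projective_scheme k, genus_two_curve iota C /\
    j_invariant (base_change iota C) 0 (iota (a * c ^+ 3)) (iota (b * c)).
Proof.
move=> ac0; have := ac0; rewrite mulf_eq0 negb_or => /andP[a0 c0].
pose g : {poly k} := a *: 'X^4 + b *: 'X^2 + c%:P.
have gE : map_poly iota g = iota a *: 'X^4 + iota b *: 'X^2 + (iota c)%:P.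
  by rewrite !rmorphD /= !map_polyZ !map_polyXn map_polyC.
have sg : (size g <= 5)%N.
  do ![apply: size_polyD_leq | exact: size_scaleXn_leq].
  by rewrite size_polyC (leq_trans (leq_b1 _)).
have [|||| C [genus2 [L [i [x [y [xy_gen xy_on model]]]]]]] :=
  @hyperelliptic_curve k K iota 'X g char2.
- by rewrite size_polyX.
- by rewrite (leq_trans (size_polyMleq _ _)) // size_polyX ltnS (leq_trans sg).
- by rewrite polyX_eq0.
- rewrite map_polyX; apply: smooth_pair_mul => [x|_].
    rewrite hornerX => ->; rewrite derivX hornerC oner_neq0 gE !hornerRE ?hornerXn.
    by rewrite !(mul0r, mulr0, add0r) fmorph_eq0.
  rewrite gE !(coefXM, coefE) /= !(mulr0, mulr1, addr0, add0r) ?mul0r ?expr0n /=.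
  by rewrite ?mulr0 ?add0r expf_neq0 // fmorph_eq0.
exists C; split=> //.
have -> : iota (a * c ^+ 3) = iota a * iota c ^+ 3 by rewrite rmorphM rmorphXn.
rewrite (rmorphM iota b c).
apply: JType13; first by rewrite -rmorphM fmorph_eq0.
apply: model; rewrite map_polyX in xy_on.
have X0 : 'X != 0 :> {poly K} by rewrite polyX_eq0.
apply: (affine_function_field_plane X0 xy_gen xy_on) => v.
rewrite hornerX gE !hornerRE ?hornerXn /curve13; set x0 := v ord0; set y0 := v ord_max.
split=> -[x0n e]; split=> //; have ec : x0 * (iota c / x0) = iota c by rewrite mulrC divfK.
  rewrite -mulrDr e; apply/(addr_eq0_pchar2 _ _ char2).
  by rewrite !mulrDr ec; ring.
apply: (mulfI x0n); rewrite mulrDr; move: e; rewrite addr_eq0_pchar2 // => ->.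
by rewrite !mulrDr ec; ring.
Qed.

Lemma exists_curve111 (a b c : k) : a * b * c != 0 ->
  exists C : projective_scheme k, genus_two_curve iota C /\
    j_invariant (base_change iota C) (iota (a * b * c)) (iota (a * b + b * c + c * a))
      (iota (a + b + c)).
Proof.
move=> abc0; have := abc0; rewrite !mulf_eq0 !negb_or => /andP[/andP[a0 b0] c0].
pose g : {poly k} := a *: 'X^3 + a *: 'X^2 + (b + c) *: 'X + b%:P.
pose h : {poly k} := 'X^2 + 'X.
have gE : map_poly iota g =
    iota a *: 'X^3 + iota a *: 'X^2 + iota (b + c) *: 'X + (iota b)%:P.
  by rewrite !rmorphD /= !map_polyZ !map_polyXn map_polyX map_polyC !rmorphD.
have hE : map_poly iota h = 'X^2 + 'X by rewrite rmorphD /= map_polyXn map_polyX.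
have sg : (size g <= 4)%N.
  do ![apply: size_polyD_leq | exact: size_scaleXn_leq];
    last by rewrite size_polyC (leq_trans (leq_b1 _)).
  by rewrite (leq_trans (size_scale_leq _ _)) // size_polyX.
have sh : (size h <= 3)%N by apply: size_polyD_leq; rewrite ?size_polyXn ?size_polyX.
have h0 : h != 0.
  by apply/eqP => /(congr1 (fun q : {poly k} => q`_2)) /eqP; rewrite !coefE addr0 oner_eq0.
have [|||| C [genus2 [L [i [x [y [xy_gen xy_on model]]]]]]] :=
  @hyperelliptic_curve k K iota h g char2.
- exact: leq_trans sh _.
- rewrite (leq_trans (size_polyMleq _ _)) //; lia.
- by [].
- rewrite hE; apply: smooth_pair_mul => [x|_].
    rewrite !hornerRE ?hornerXn => ex.
    have -> : ('X^2 + 'X)^`().[x] = 1 :> K.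
      rewrite derivD derivXn derivX hornerD hornerMn hornerXn hornerC expr1 mulr2n.
      by rewrite (addrr_pchar2 char2) add0r.
    split; first exact: oner_neq0.
    rewrite gE !hornerRE ?hornerXn rmorphD.
    have /eqP : x * (x + 1) = 0 by rewrite -[RHS]ex; ring.
    rewrite mulf_eq0 addr_eq0 oppr_pchar2 // => /orP[] /eqP ->.
      by rewrite !(mul0r, mulr0, add0r) fmorph_eq0.
    rewrite !mulr1 (addrr_pchar2 char2) add0r addrAC (addrr_pchar2 char2) add0r.
    by rewrite fmorph_eq0.
  (* Infinity is the third pole: the coefficients of h g of index six and five are 0 and a. *)
  rewrite gE mulrDl !coefD coefXnM coefXM coefXnM coefXM !coefE /=.
  rewrite !(mulr0, mulr1, addr0, add0r, mul0r).
  by rewrite expf_neq0 // fmorph_eq0.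
exists C; split=> //.
have -> : iota (a * b * c) = iota a * iota b * iota c by rewrite !rmorphM.
have -> : iota (a * b + b * c + c * a) = iota a * iota b + iota b * iota c + iota c * iota a.
  by rewrite !rmorphD !rmorphM.
have -> : iota (a + b + c) = iota a + iota b + iota c by rewrite !rmorphD.
apply: JType111; first by rewrite -!rmorphM fmorph_eq0.
apply: model.
have H0 : map_poly iota h != 0 by rewrite map_poly_eq0.
apply: (affine_function_field_plane H0 xy_gen xy_on) => v.
rewrite hE gE rmorphD; exact: curve111P.
Qed.

(** In characteristic two X^2 - z has derivative zero, so it is not separable; over a perfect field
    it is then reducible and has a root. *)
Lemma perfect_sqrt (char2' : 2%N \in [pchar k]) : perfect_field k ->
  forall z : k, exists r, r ^+ 2 = z.
Proof.
move=> perf z; have [//|nosqrt] := classic (exists r, r ^+ 2 = z).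
have irr : irreducible_poly ('X^2 - z%:P).
  apply: cubic_irreducible => [|r]; first by rewrite size_XnsubC.
  apply/negP => /rootP; rewrite !hornerE ?hornerXn => /subr0_eq er.
  by apply: nosqrt; exists r.
have := perf _ irr; rewrite unlock derivB derivXn derivC subr0.
rewrite -[_ *+ 2]scaler_nat (pcharf0 char2') scale0r coprimep0.
by rewrite -size_poly_eq1 size_XnsubC.
Qed.

(* The poles of the type (1,1,1) equation are moved to the roots of the cubic E,
   so that the Galois action on the residues a, b, c matches the one on the
   poles. *)
Lemma exists_curve_separable (j1 j2 j3 : k) : 2%N \in [pchar k] ->
  j1 != 0 -> j1 + j2 * j3 != 0 ->
  exists C : projective_scheme k, genus_two_curve iota C /\
    j_invariant (base_change iota C) (iota j1) (iota j2) (iota j3).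
Proof.
move=> char2k j10 D0; pose D := j1 + j2 * j3.
pose E : {poly k} := 'X^3 + j3 *: 'X^2 + j2 *: 'X + j1%:P.
(* The derivative of [E], since 3 = 1 and 2 = 0 in [k]. *)
pose dE : {poly k} := 'X^2 + j2%:P.
(* Reduction modulo [E] keeps the values at its roots, hence the residues, and brings the degree
   below three, so that infinity is not a pole. *)
pose g : {poly k} := D^-1 *: ('X * dE ^+ 3 %% E).
have sE : size E = 4%N.
  rewrite /E -!addrA size_polyDl size_polyXn // ltnS.
  apply: size_polyD_leq; first exact: size_scaleXn_leq.
  apply: size_polyD_leq; first by rewrite (leq_trans (size_scale_leq _ _)) // size_polyX.
  by rewrite size_polyC (leq_trans (leq_b1 _)).
have E0 : E != 0 by rewrite -size_poly_eq0 sE.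
have sg : (size g <= 3)%N.
  by rewrite (leq_trans (size_scale_leq _ _)) // -ltnS -sE ltn_modp.
pose e := iota j3; pose e' := iota j2; pose e'' := iota j1; pose d := iota D.
have EE : map_poly iota E = 'X^3 + e *: 'X^2 + e' *: 'X + e''%:P.
  by rewrite !rmorphD /= !map_polyZ !map_polyXn map_polyX map_polyC.
have dEE : map_poly iota dE = 'X^2 + e'%:P by rewrite rmorphD /= map_polyXn map_polyC.
have d0 : d != 0 by rewrite fmorph_eq0.
have dbl (z : K) : z + z = 0 by exact: addrr_pchar2.
have dblk (p : {poly k}) : p *+ 2 = 0 by rewrite -scaler_nat (pcharf0 char2k) scale0r.
have dEq : (map_poly iota E)^`() = map_poly iota dE.
  rewrite deriv_map /E !derivD !derivZ !derivXn derivX derivC mulrSr !dblk.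
  by rewrite scaler0 add0r !addr0 /dE -alg_polyC.
(* In characteristic two E = (X + j3) E' + D, so a common root of E and E' would force D = 0. *)
have Ex x : (map_poly iota E).[x] = 0 -> (map_poly iota dE).[x] = 0 -> False.
  rewrite EE dEE !hornerRE => Ex0; rewrite addr_eq0_pchar2 // => ex.
  case/negP: d0; rewrite /d /D rmorphD rmorphM -/e -/e' -/e'' -Ex0 -ex.
  apply/eqP.
  transitivity (2%:R * x ^+ 3 + (e'' + x * x * e)).
    by rewrite (pcharf0 char2) mul0r add0r.
  by ring.
have [rs Ers] := closed_field_poly_normal (map_poly iota E).
have monE : lead_coef (map_poly iota E) = 1.
  rewrite lead_coef_map_eq ?fmorph_eq0 ?lead_coef_eq0 // /lead_coef sE /E.
  by rewrite !coefE /= !(mulr0, addr0) rmorph1.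
rewrite monE scale1r in Ers.
have srs : size rs = 3%N.
  by apply/eqP; rewrite -eqSS -(size_prod_XsubC _ id) -Ers size_map_poly sE.
case: rs srs Ers => [|a [|b [|c [|//]]]] // _.
have sX (z : K) : 'X - z%:P = 'X + z%:P by rewrite -polyCN oppr_pchar2.
rewrite !big_cons big_nil mulr1 !sX => Eabc.
have Eexp : map_poly iota E =
    'X^3 + (a + b + c) *: 'X^2 + (a * b + b * c + c * a) *: 'X + (a * b * c)%:P.
  by rewrite Eabc -!mul_polyC !rmorphD !rmorphM /=; ring.
have [e3 e2 e1] : [/\ e = a + b + c, e' = a * b + b * c + c * a & e'' = a * b * c].
  have co l := congr1 (fun q : {poly K} => q`_l) (etrans (esym EE) Eexp).
  move: (co 2%N) (co 1%N) (co 0%N).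
  by rewrite /= !coefE /= !(mulr0, mulr1, addr0, add0r) => -> -> ->.
have hE z : (map_poly iota E).[z] = (z + a) * (z + b) * (z + c) by rewrite Eabc !hornerRE; ring.
have hdE z : (map_poly iota dE).[z] = z ^+ 2 + e' by rewrite dEE !hornerRE ?hornerXn.
have dEa : (map_poly iota dE).[a] = (a + b) * (a + c) by rewrite hdE e2; ring.
have dEb : (map_poly iota dE).[b] = (a + b) * (b + c) by rewrite hdE e2; ring.
have dEc : (map_poly iota dE).[c] = (a + c) * (b + c) by rewrite hdE e2; ring.
have Ea : (map_poly iota E).[a] = 0 by rewrite hE dbl !mul0r.
have Eb : (map_poly iota E).[b] = 0 by rewrite hE dbl mulr0 mul0r.
have Ec : (map_poly iota E).[c] = 0 by rewrite hE dbl mulr0.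
have ab : a + b != 0 by apply/eqP => ab; apply: (Ex a Ea); rewrite dEa ab mul0r.
have ac : a + c != 0 by apply/eqP => ac; apply: (Ex a Ea); rewrite dEa ac mulr0.
have bc : b + c != 0 by apply/eqP => bc; apply: (Ex b Eb); rewrite dEb bc mulr0.
have dE3 : d = (a + b) * (b + c) * (a + c).
  rewrite /d /D rmorphD rmorphM -/e -/e' -/e'' e1 e2 e3.
  transitivity ((a + b) * (b + c) * (a + c) + 2%:R * (a * b * c)); first by ring.
  by rewrite (pcharf0 char2) mul0r addr0.
pose N := map_poly iota ('X * dE ^+ 3 %% E).
have gE : map_poly iota g = d^-1 *: N by rewrite map_polyZ fmorphV.
have NE z : (map_poly iota E).[z] = 0 -> N.[z] = z * (map_poly iota dE).[z] ^+ 3.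
  move=> /rootP Ez; rewrite /N map_modp horner_modp_root //.
  by rewrite rmorphM rmorphXn /= map_polyX hornerM horner_exp hornerX.
have abc0 : a * b * c != 0 by rewrite -e1 fmorph_eq0.
have [|||| C [genus2 [L [i [x [y [xy_gen xy_on model]]]]]]] :=
  @hyperelliptic_curve k K iota E g char2.
- by rewrite sE.
- by rewrite (leq_trans (size_polyMleq _ _)) // sE; lia.
- exact: E0.
- apply: smooth_pair_mul => [z Ez|].
    rewrite dEq; have dz : (map_poly iota dE).[z] != 0 by apply/eqP; exact: Ex.
    split=> //; rewrite gE hornerZ NE // !mulf_neq0 ?invr_eq0 ?expf_neq0 //.
    apply: contra abc0 => /eqP z0; rewrite -e1 -Ez z0 EE !hornerRE.
    by rewrite !(mul0r, mulr0, add0r).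
  (* [E] has degree three, so the condition at infinity is vacuous. *)
  by move: monE; rewrite lead_coefE size_map_poly sE /= => -> /eqP; rewrite oner_eq0.
exists C; split=> //; rewrite -/e -/e' -/e'' e1 e2 e3; apply: JType111 => //; apply: model.
have sXX (u v : K) : (size (('X + u%:P) * ('X + v%:P))%R <= 3)%N.
  by rewrite -!sX (leq_trans (size_polyMleq _ _)) // !size_XsubC.
have NM : N = residue_poly a b c.
  (* Both sides have degree at most two and agree at three distinct points: at [a] only the first
     term of [residue_poly] survives, and it equals a E'(a)^3; likewise at [b] and [c]. *)
  apply/eqP; rewrite -subr_eq0; apply/eqP.
  apply: (@roots_geq_poly_eq0 _ _ [:: a; b; c]) => /=.
  - rewrite /root !(hornerD, hornerN) !NE // dEa dEb dEc /residue_poly !hornerRE !dbl.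
    rewrite !(mul0r, mulr0, add0r, addr0) [b + a]addrC [c + a]addrC [c + b]addrC.
    by apply/and4P; split=> //; apply/eqP; ring.
  - have neq (u v : K) : u + v != 0 -> u != v by apply: contra => /eqP->; rewrite dbl.
    by rewrite !inE !negb_or (neq a b) ?(neq a c) ?(neq b c).
  rewrite (leq_trans (size_polyD _ _)) // size_polyN geq_max; apply/andP; split.
    by rewrite size_map_poly -ltnS -sE ltn_modp.
  by apply: size_polyD_leq; [apply: size_polyD_leq|]; rewrite (leq_trans (size_scale_leq _ _)) ?sXX.
apply: (affine_function_field_curve111 char2 (And3 ab ac bc) xy_gen).
by move: xy_on; rewrite gE NM dE3 Eabc !mulrA.
Qed.


End Types.

Theorem theorem22 (k : fieldType) (char2 : 2%N \in [pchar k])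
    (hk : perfect_field k) (K : closedFieldType) (iota : {rmorphism k -> K})
    (hK : algebraic_closure iota) (j1 j2 j3 : k) :
  exists C : projective_scheme k,
    genus_two_curve iota C /\
    j_invariant (base_change iota C) (iota j1) (iota j2) (iota j3).
Proof.
have char2K : 2%N \in [pchar K] by exact: rmorph_pchar char2.
have [j10|j10] := eqVneq j1 0; last first.
  have [D0|D0] := eqVneq (j1 + j2 * j3) 0; last exact: exists_curve_separable.
  have [r er] := perfect_sqrt char2 hk j2.
  (* Here E = (X + j3) (X^2 + j2) = (X + j3) (X + r)^2, which gives the triple j3, r, r. *)
  have ej1 : j1 = j3 * r * r.
    by have /(addr_eq0_pchar2 _ _ char2) -> := D0; rewrite -er; ring.
  have [|C [genus2 jC]] := @exists_curve111 k K iota char2K j3 r r.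
    by rewrite -ej1.
  exists C; split=> //; move: jC; rewrite -ej1.
  have -> : j3 * r + r * r + r * j3 = j2.
    transitivity (r ^+ 2 + 2%:R * (j3 * r)); first by ring.
    by rewrite (pcharf0 char2) mul0r addr0.
  by rewrite -addrA (addrr_pchar2 char2) addr0.
have [j20|j20] := eqVneq j2 0; last first.
  (* Taking c = 1 leaves a = j2 and b = j3. *)
  have [|C [genus2 jC]] := @exists_curve13 k K iota char2K j2 j3 1; first by rewrite mulr1.
  by exists C; split=> //; move: jC; rewrite expr1n !mulr1 j10 rmorph0.
rewrite j10 j20 rmorph0; have [->|j30] := eqVneq j3 0.
  have [C [genus2 jC]] := exists_curve5 iota char2K 0 (oner_neq0 k).
  by exists C; split=> //; move: jC; rewrite expr0n mul0r.
(* With these values c^5 / a^3 = j3^10 / j3^9; for j3 = 0 they would give a = 0, whence the separate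
   case. *)
have [|C [genus2 jC]] := @exists_curve5 k K iota char2K (j3 ^+ 3) (j3 ^+ 2).
  by rewrite expf_neq0.
exists C; split=> //; move: jC; congr (j_invariant _ _ _ (iota _)).
by rewrite -!exprM; apply: (mulIf (expf_neq0 9 j30)); rewrite divfK ?expf_neq0 // -exprS.
Qed.
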